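(* Let $\mathcal{H}$ be a non-central hyperplane arrangement in $\mathbb{R}^n$ with intersection lattice $\mathcal{L}$, face lattice $T$, and poset $Q$ of unbounded faces. Let $z_{ub}:Q\to\mathcal{L}\cup\{\hat0\}$ send each unbounded face to its affine hull, the minimal element of $Q$ to the adjoined $\hat0$, and the maximal element of $Q$ to $\emptyset=\hat1$. Let $c=\{\hat0=x_0<x_1<\cdots<x_k=\hat1\}$ be a chain in $\mathcal{L}\cup\{\hat0\}$ with $k\ge2$. Then the number of chains $\{y_0<y_1<\cdots<y_k\}$ in $Q$ with $z_{ub}(y_i)=x_i$ for all $i$ is $$|z_{ub}^{-1}(c)|=\prod_{i=2}^{k-1}Z([x_{i-1},x_i])\cdot Z_{ub}([x_{k-1},x_k]).$$
   Context: An essential hyperplane arrangement in $\mathbb{R}^n$ is a finite set of affine hyperplanes whose normals span $\mathbb{R}^n$; it is non-central if the intersection of all hyperplanes is empty. Its intersection lattice $\mathcal{L}$ consists of all intersections of subsets of hyperplanes ordered by reverse inclusion (minimum $\mathbb{R}^n$, maximum $\emptyset$), and $\mathcal{L}\cup\{\hat0\}$ adjoins a new minimum. The face lattice $T$ consists of the (relatively open) faces of the decomposition of $\mathbb{R}^n$ induced by $\mathcal{H}$, ordered by $F\le G$ iff $F\subseteq\overline G$, together with an adjoined minimum (the empty face) and an adjoined maximum $\hat1_T$; $T^*$ is the dual. The unbounded faces together with $\hat1_T$ form a lower order ideal of $T^*$; $Q$ is this ideal with a new maximum adjoined. For a graded poset $P$ with rank $\rho$ and Möbius function $\mu$: $Z(P)=\sum_{\hat0\le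 x\le\hat1}(-1)^{\rho(x)}\mu(\hat0,x)$, $Z_b(P)=(-1)^{\rho(P)}\mu(\hat0,\hat1)$, $Z_{ub}(P)=Z(P)-2Z_b(P)$; intervals are regarded as graded posets. *)

(* Defs.v *)
From HB Require Import structures.
From mathcomp Require Import all_boot all_order all_algebra.
From mathcomp Require Import finmap.
From mathcomp Require Import all_classical all_reals.
From mathcomp Require Import topology normedtype.

Set Implicit Arguments.
Unset Strict Implicit.
Unset Printing Implicit Defensive.

Import Order.TTheory GRing.Theory Num.Theory.
Import numFieldNormedType.Exports.

Local Open Scope ring_scope.

Section Poset.
Context {d : Order.disp_t} {P : finPOrderType d}.
Implicit Types x y z : P.

(* The recursion mu(x,x) = 1, mu(x,y) = - \sum_(x <= z < y) mu(x,z), with fuel;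
   [mobius_xx], [mobius_lt] and [mobius_nle] show that the fuel suffices. *)
Fixpoint mobius_rec (k : nat) x y : int :=
  if x == y then 1 else
  if k is k'.+1 then
    - \sum_(z : P | (x <= z)%O && (z < y)%O) mobius_rec k' x z
  else 0.

Definition mobius x y : int := mobius_rec #|P| x y.

(* Rank of z in a graded poset with minimum x: the length of a longest (in a
   graded poset, of any maximal) chain of [x, z]. *)
Definition rank x z : nat :=
  \max_(C : {set P} |
      [forall u in C, (x <= u)%O && (u <= z)%O] &&
      [forall u in C, forall v in C, (u >=< v)%O]) #|C|.-1.

(* Z, Z_b and Z_ub of the interval [x, y], viewed as a graded poset with its own
   rank function; the interval [\bot, \top] gives the invariants of P itself. *)
Definition Z x y : int :=
  \sum_(z : P | (x <= z)%O && (z <= y)%O) (-1) ^+ rank x z * mobius x z.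

Definition Zb x y : int := (-1) ^+ rank x y * mobius x y.

Definition Zub x y : int := Z x y - 2 * Zb x y.

Definition chain k (c : 'I_k.+1 -> P) : bool :=
  [forall i : 'I_k.+1, forall j : 'I_k.+1, (i < j)%N ==> (c i < c j)%O].

Lemma mobius_recE k l x y :
  (#|[set z : P | (x <= z)%O && (z < y)%O]| <= k)%N ->
  (#|[set z : P | (x <= z)%O && (z < y)%O]| <= l)%N ->
  (x <= y)%O ->
  mobius_rec k x y = mobius_rec l x y.
Proof.
elim: k l y => [|k IH] l y hk hl xy.
  case: l hl => // l _ /=; case: eqVneq => // nxy.
  move: hk; rewrite leqn0 cards_eq0 => /eqP/setP/(_ x).
  by rewrite !inE lexx lt_neqAle nxy xy.
case: l hl => [|l] hl /=; case: eqVneq => // nxy.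
  move: hl; rewrite leqn0 cards_eq0 => /eqP/setP/(_ x).
  by rewrite !inE lexx lt_neqAle nxy xy.
congr (- _); apply: eq_bigr => z /andP[xz zy].
have sub : (#|[set w : P | (x <= w)%O && (w < z)%O]| <
            #|[set w : P | (x <= w)%O && (w < y)%O]|)%N.
  apply: proper_card; apply/properP; split.
    apply/fintype.subsetP => w; rewrite !inE => /andP[-> wz] /=.
    exact: lt_trans wz zy.
  by exists z; rewrite !inE ?xz ?zy ?ltxx ?andbF.
apply: IH => //; rewrite -ltnS; exact: leq_trans sub _.
Qed.

Lemma mobius_xx x : mobius x x = 1.
Proof. by rewrite /mobius; case: #|P| => [|k] /=; rewrite eqxx. Qed.

Lemma mobius_lt x y : (x < y)%O ->
  mobius x y = - \sum_(z : P | (x <= z)%O && (z < y)%O) mobius x z.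
Proof.
move=> xy; rewrite /mobius.
rewrite (@mobius_recE _ #|P|.+1) ?max_card ?ltW //; last first.
  exact: leq_trans (max_card _) (leqnSn _).
rewrite [LHS]/= lt_eqF //.
Qed.

Lemma mobius_nle x y : ~~ (x <= y)%O -> mobius x y = 0.
Proof.
rewrite /mobius => xy; have nxy : (x == y) = false.
  by apply/negbTE; apply: contra xy => /eqP->.
case: #|P| => [|k] /=; rewrite nxy // big_pred0 ?oppr0 // => z.
by apply/negbTE; apply: contra xy => /andP[xz /ltW]; apply: le_trans.
Qed.

End Poset.

Definition adjoin_min (T : Type) : Type := option T.
Definition adjoin_max (T : Type) : Type := option T.

HB.instance Definition _ (T : finType) :=
  Finite.copy (adjoin_min T) (option T).
HB.instance Definition _ (T : finType) :=
  Finite.copy (adjoin_max T) (option T).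

Section Adjoin.
Context {d : Order.disp_t} {P : finPOrderType d}.

Definition adjoin_min_le (x y : adjoin_min P) : bool :=
  match x, y with
  | None, _ => true
  | Some _, None => false
  | Some a, Some b => (a <= b)%O
  end.

Definition adjoin_max_le (x y : adjoin_max P) : bool :=
  match x, y with
  | _, None => true
  | None, Some _ => false
  | Some a, Some b => (a <= b)%O
  end.

Fact adjoin_min_le_refl : reflexive adjoin_min_le.
Proof. by case=> [a|] //=. Qed.
Fact adjoin_min_le_anti : antisymmetric adjoin_min_le.
Proof. by move=> [a|] [b|] //= /le_anti ->. Qed.
Fact adjoin_min_le_trans : transitive adjoin_min_le.
Proof. by move=> [b|] [a|] [c|] //=; apply: le_trans. Qed.
Fact adjoin_max_le_refl : reflexive adjoin_max_le.
Proof. by case=> [a|] //=. Qed.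
Fact adjoin_max_le_anti : antisymmetric adjoin_max_le.
Proof. by move=> [a|] [b|] //= /le_anti ->. Qed.
Fact adjoin_max_le_trans : transitive adjoin_max_le.
Proof. by move=> [b|] [a|] [c|] //=; apply: le_trans. Qed.

HB.instance Definition _ := Order.Le_isPOrder.Build d (adjoin_min P)
  adjoin_min_le_refl adjoin_min_le_anti adjoin_min_le_trans.
HB.instance Definition _ := Order.Le_isPOrder.Build d (adjoin_max P)
  adjoin_max_le_refl adjoin_max_le_anti adjoin_max_le_trans.

Fact adjoin_min_le0x (x : adjoin_min P) : ((None : adjoin_min P) <= x)%O.
Proof. by []. Qed.
Fact adjoin_max_lex1 (x : adjoin_max P) : (x <= (None : adjoin_max P))%O.
Proof. by case: x. Qed.

HB.instance Definition _ :=
  Order.hasBottom.Build d (adjoin_min P) adjoin_min_le0x.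
HB.instance Definition _ :=
  Order.hasTop.Build d (adjoin_max P) adjoin_max_lex1.

End Adjoin.

Section AdjoinTop.
Context {d : Order.disp_t} {P : finTPOrderType d}.

Fact adjoin_min_lex1 (x : adjoin_min P) : (x <= (Some \top%O : adjoin_min P))%O.
Proof. by case: x => [a|//]; apply: (lex1 a). Qed.

HB.instance Definition _ :=
  Order.hasTop.Build d (adjoin_min P) adjoin_min_lex1.

End AdjoinTop.

Local Open Scope classical_set_scope.

Section Hyperplanes.
Context {R : realType} {n : nat}.
Local Notation V := 'rV[R]_n.

Definition dot (a x : V) : R := \sum_(i < n) a 0 i * x 0 i.

Definition hyp (a : V) (b : R) : set V := [set x | dot a x = b].

Definition normal (h : set V) (a : V) : Prop :=
  a != 0 /\ exists b, h = hyp a b.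

Definition is_hyperplane (h : set V) : Prop := exists a, normal h a.

Definition essential (H : {fset set V}) : Prop :=
  exists s : seq V,
    (forall a, a \in s -> exists2 h, h \in H & normal h a) /\
    (<<s>> = fullv)%VS.

Definition noncentral (H : {fset set V}) : Prop :=
  \bigcap_(h in [set` H]) h = set0.

Definition aff_hull (A : set V) : set V :=
  [set y | exists (k : nat) (p : 'I_k -> V) (c : 'I_k -> R),
     [/\ forall i, A (p i), \sum_i c i = 1 & y = \sum_i c i *: p i]].

(* x and y lie on the same side of, or both on, each hyperplane of H.  The
   condition does not depend on the equation (a, b) representing it. *)
Definition same_face (H : {fset set V}) (x y : V) : Prop :=
  forall a b, a != 0 -> hyp a b \in H ->
    Num.sg (dot a x - b) = Num.sg (dot a y - b).

Definition is_face (H : {fset set V}) (F : set V) : Prop :=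
  exists x, F = [set y | same_face H x y].

Lemma dotD a x y : dot a (x + y) = dot a x + dot a y.
Proof. by rewrite -big_split; apply: eq_bigr => i _; rewrite mxE mulrDr. Qed.

Lemma dotZ a c x : dot a (c *: x) = c * dot a x.
Proof.
by rewrite /dot mulr_sumr; apply: eq_bigr => i _; rewrite mxE mulrCA.
Qed.

Lemma dot_sum a k (c : 'I_k -> R) (p : 'I_k -> V) :
  dot a (\sum_i c i *: p i) = \sum_i c i * dot a (p i).
Proof.
elim/big_rec2: _ => [|i y1 y2 _ <-]; last by rewrite dotD dotZ.
by rewrite /dot big1 // => i _; rewrite mxE mulr0.
Qed.

Lemma dot_gt0 a : a != 0 -> 0 < dot a a.
Proof.
move=> a0; rewrite lt_neqAle eq_sym; apply/andP; split; last first.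
  by apply: sumr_ge0 => i _; rewrite -expr2 sqr_ge0.
apply: contra a0; rewrite psumr_eq0; last by move=> i _; rewrite -expr2 sqr_ge0.
move/allP => h; apply/eqP/rowP => i; rewrite mxE.
by move/(_ i): h; rewrite mem_index_enum mulf_eq0 orbb => /(_ isT)/eqP.
Qed.

Lemma hyp_eqP a b a' b' : a != 0 -> hyp a b = hyp a' b' ->
  exists c, forall x, dot a' x - b' = c * (dot a x - b).
Proof.
move=> a0 e; exists (dot a' a / dot a a) => x.
have a2 : dot a a != 0 by rewrite gt_eqF // dot_gt0.
have : hyp a b (x + (- ((dot a x - b) / dot a a)) *: a).
  by rewrite /hyp/= dotD dotZ mulNr divfK // opprB addrC subrK.
rewrite e /hyp/= dotD dotZ => <-.
by rewrite opprD mulNr opprK addrA subrr add0r mulrC mulrA mulrAC.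
Qed.

Lemma dot_continuous a : continuous (dot a).
Proof.
have add_cont : continuous (fun z : R * R => z.1 + z.2).
  by move=> z; apply: cvgD; [exact: cvg_fst|exact: cvg_snd].
apply: (continuous_big (x0 := 0) (P := predT) add_cont) => i _ x.
have ci : y 0 i @[y --> x] --> x 0 i by exact: coord_continuous.
exact: cvgM (cvg_cst (a 0 i)) ci.
Qed.

Lemma sgr_eq (u v : R) :
  (u == 0) = (v == 0) -> (0 < u) = (0 < v) -> Num.sg u = Num.sg v.
Proof.
by case: (ltgtP v 0) => [v0|v0|->]; case: (ltgtP u 0) => [u0|u0|->] //;
  rewrite ?(ltr0_sg v0) ?(ltr0_sg u0) ?(gtr0_sg v0) ?(gtr0_sg u0).
Qed.

Lemma same_face_refl H x : same_face H x x.
Proof. by []. Qed.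

Lemma faces_finite (H : {fset set V}) : finite_set [set F | is_face H F].
Proof.
pose rep (h : set V) : V * R :=
  xget (0, 0) [set ab : V * R | ab.1 != 0 /\ h = hyp ab.1 ab.2].
pose f (h : set V) x := dot (rep h).1 x - (rep h).2.
pose E (s : {ffun H -> bool * bool}) : set V :=
  [set y | forall h : H,
     is_hyperplane (val h) ->
     s h = (f (val h) y == 0, 0 < f (val h) y)].
apply: (@sub_finite_set _ _ (E @` setT)); last exact: finite_image.
move=> F [x ->]; exists [ffun h => (f (val h) x == 0, 0 < f (val h) x)] => //.
have repP h : is_hyperplane h -> (rep h).1 != 0 /\ h = hyp (rep h).1 (rep h).2.
  move=> [a [a0 [b hE]]]; rewrite /rep; case: xgetP => [ab _ //|].
  by move=> /(_ (a, b)) []; split.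
apply/seteqP; split => y /=; last first.
  move=> xy h hh; rewrite ffunE.
  have [r0 rE] := repP _ hh.
  have := xy _ (rep (val h)).2 r0; rewrite -rE => /(_ (valP h)); rewrite -!/(f _ _) => e.
  by rewrite -sgr_eq0 e sgr_eq0 -[0 < f _ x]sgr_gt0 e sgr_gt0.
move=> xy a b a0 hH.
have hh : is_hyperplane (hyp a b) by exists a; split => //; exists b.
have [r0 rE] := repP _ hh.
have [c cE] := hyp_eqP r0 (esym rE).
rewrite !cE !sgrM; congr (_ * _).
have := xy [` hH]%fset hh; rewrite ffunE -!/(f _ _) => -[e1 e2].
exact: sgr_eq e1 e2.
Qed.

Definition faces (H : {fset set V}) : {fset set V} :=
  fset_set [set F | is_face H F].

Lemma facesP (H : {fset set V}) F : reflect (is_face H F) (F \in faces H).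
Proof.
apply: (iffP idP); first by rewrite in_fset_set ?inE //; exact: faces_finite.
by move=> hF; rewrite in_fset_set ?inE //; exact: faces_finite.
Qed.

(* G ranges over all subsets of H; the empty one gives the whole space. *)
Definition flats (H : {fset set V}) : {fset set V} :=
  [fset (\bigcap_(h in [set` (G : {fset set V})]) h)%classic | G in fpowerset H]%fset.

Lemma flatsP (H : {fset set V}) (X : set V) :
  reflect (exists2 G : {fset set V}, (G `<=` H)%fset &
             X = \bigcap_(h in [set` G]) h) (X \in flats H).
Proof.
apply: (iffP idP) => [/imfsetP[G /= GH ->]|[G GH ->]].
  by exists G => //; rewrite -fpowersetE.
by apply/imfsetP; exists G; rewrite //= fpowersetE.
Qed.

Definition lattice (H : {fset set V}) : Type := fset_sub_type (flats H).

HB.instance Definition _ H := Finite.copy (lattice H) (fset_sub_type (flats H)).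

Definition lattice_le H (X Y : lattice H) : bool :=
  `[< fsval Y `<=` fsval X >].

Fact lattice_le_refl H : reflexive (@lattice_le H).
Proof. by move=> X; apply/asboolP. Qed.
Fact lattice_le_anti H : antisymmetric (@lattice_le H).
Proof.
by move=> X Y /andP[/asboolP h1 /asboolP h2]; apply/val_inj/seteqP; split.
Qed.
Fact lattice_le_trans H : transitive (@lattice_le H).
Proof.
move=> Y X Z /asboolP h1 /asboolP h2; apply/asboolP.
exact: subset_trans h2 h1.
Qed.

HB.instance Definition _ H :=
  Order.Le_isPOrder.Build Order.default_display (lattice H)
  (@lattice_le_refl H) (@lattice_le_anti H) (@lattice_le_trans H).

Fact lattice_top_subproof H : \bigcap_(h in [set` H]) h \in flats H.
Proof. by apply/flatsP; exists H. Qed.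

Definition lattice_top H : lattice H := [` lattice_top_subproof H]%fset.

Fact lattice_lex1 H (X : lattice H) : (X <= lattice_top H)%O.
Proof.
apply/asboolP => /=; have /flatsP[G /fsubsetP GH ->] := valP X.
by move=> x hx h hG; apply: hx; apply: GH.
Qed.

HB.instance Definition _ H :=
  Order.hasTop.Build _ (lattice H) (@lattice_lex1 H).

Lemma lattice_topE H : noncentral H -> fsval (\top%O : lattice H) = set0.
Proof. by []. Qed.

Definition face (H : {fset set V}) : Type := fset_sub_type (faces H).

HB.instance Definition _ H := Finite.copy (face H) (fset_sub_type (faces H)).

Definition face_le H (F G : face H) : bool :=
  `[< fsval F `<=` closure (fsval G) >].

Lemma closure_face_sign H x y a b :
  a != 0 -> hyp a b \in H -> closure [set z | same_face H y z] x ->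
  (0 <= dot a y - b -> 0 <= dot a x - b) /\
  (dot a y - b <= 0 -> dot a x - b <= 0).
Proof.
move=> a0 hH cl; split => hy.
  have cl' : closed (dot a @^-1` [set r | b <= r]).
    by apply: preimage_closed; [move=> z _; exact: dot_continuous|exact: closed_ge].
  rewrite subr_ge0; apply: (cl') => U /cl [z [yz Uz]]; exists z; split => //=.
  by rewrite -subr_ge0 -sgr_ge0 -(yz _ _ a0 hH) sgr_ge0.
have cl' : closed (dot a @^-1` [set r | r <= b]).
  by apply: preimage_closed; [move=> z _; exact: dot_continuous|exact: closed_le].
rewrite subr_le0; apply: (cl') => U /cl [z [yz Uz]]; exists z; split => //=.
by rewrite -subr_le0 -sgr_le0 -(yz _ _ a0 hH) sgr_le0.
Qed.

Fact face_le_refl H : reflexive (@face_le H).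
Proof. by move=> F; apply/asboolP; exact: subset_closure. Qed.
Fact face_le_anti H : antisymmetric (@face_le H).
Proof.
move=> F G /andP[/asboolP h1 /asboolP h2]; apply/val_inj.
have /facesP[x Fx] := valP F; have /facesP[y Gy] := valP G.
have cx : closure [set z | same_face H y z] x.
  by rewrite -Gy; apply: h1; rewrite [val F]Fx; exact: same_face_refl.
have cy : closure [set z | same_face H x z] y.
  by rewrite -Fx; apply: h2; rewrite [val G]Gy; exact: same_face_refl.
have xy : same_face H x y.
  move=> a b a0 hH.
  have [p1 p2] := closure_face_sign a0 hH cx.
  have [q1 q2] := closure_face_sign a0 hH cy.
  case: (ltgtP (dot a x - b) 0) => hx.
  - rewrite (ltr0_sg hx); case: (ltP (dot a y - b) 0) => hy.
      by rewrite ltr0_sg.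
    by move: (lt_le_trans hx (p1 hy)); rewrite ltxx.
  - rewrite (gtr0_sg hx); case: (ltP 0 (dot a y - b)) => hy.
      by rewrite gtr0_sg.
    by move: (lt_le_trans hx (p2 hy)); rewrite ltxx.
  - rewrite hx; congr Num.sg; apply/esym/le_anti.
    by rewrite q1 ?hx // q2 ?hx.
rewrite [LHS]Fx [RHS]Gy; apply/seteqP; split => z hz a b a0 hH.
  by rewrite -(xy _ _ a0 hH) hz.
by rewrite (xy _ _ a0 hH) hz.
Qed.
Fact face_le_trans H : transitive (@face_le H).
Proof.
move=> G F K /asboolP h1 /asboolP h2; apply/asboolP.
apply: (subset_trans h1); have /closure_id cK := @closed_closure _ (val K).
by rewrite [X in _ `<=` X]cK; exact: closure_subset.
Qed.

HB.instance Definition _ H :=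
  Order.Le_isPOrder.Build Order.default_display (face H)
  (@face_le_refl H) (@face_le_anti H) (@face_le_trans H).

(* Some (Some F) is the face F, Some None the empty face (the minimum) and None
   the adjoined maximum; the latter is the minimum of the dual. *)
Definition face_lattice H : Type := adjoin_max (adjoin_min (face H)).

HB.instance Definition _ H := Order.FinTPOrder.on (face_lattice H).

Definition in_ub_ideal H (t : (face_lattice H)^d%type) : bool :=
  match t : face_lattice H with
  | None => true
  | Some None => false
  | Some (Some F) => ~~ `[< bounded_set (fsval F) >]
  end.

Definition ub_ideal H : Type :=
  {t : (face_lattice H)^d%type | in_ub_ideal t}.

HB.instance Definition _ H := Finite.on (ub_ideal H).
HB.instance Definition _ H :=
  SubFinite.on (ub_ideal H).
HB.instance Definition _ H :=
  [SubChoice_isSubPOrder of (ub_ideal H) by <: with Order.default_display].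

Definition Q H : Type := adjoin_max (ub_ideal H).

HB.instance Definition _ H := Order.FinTPOrder.on (Q H).

Lemma small_move (H : {fset set V}) (x y : V) :
  (forall a b, a != 0 -> hyp a b \in H -> dot a x = b -> dot a y = b) ->
  exists2 e : R, 0 < e & same_face H x (x + e *: (y - x)).
Proof.
move=> hxy.
suff [e e0 he] : exists2 e : R, 0 < e & forall e', 0 < e' <= e ->
    forall a b, a != 0 -> hyp a b \in enum_fset H ->
    Num.sg (dot a x - b) = Num.sg (dot a (x + e' *: (y - x)) - b).
  by exists e => // a b a0 hH; apply: he => //; rewrite e0 lexx.
have: {subset enum_fset H <= H} by [].
elim: (enum_fset H) => [|h s IH] sH; first by exists 1 => //.
have [|e1 e10 he1] := IH; first by move=> z zs; apply: sH; rewrite inE zs orbT.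
have [[a [a0 [b hE]]]|nh] := pselect (is_hyperplane h); last first.
  exists e1 => // e' e'e a b a0; rewrite inE => /orP[/eqP hE|]; last exact: he1.
  by case: nh; exists a; split => //; exists b.
have [e2 e20 he2] : exists2 e2 : R, 0 < e2 & forall e', 0 < e' <= e2 ->
    Num.sg (dot a x - b) = Num.sg (dot a (x + e' *: (y - x)) - b).
  pose u := dot a x - b; pose v := dot a (y - x).
  have uv e' : dot a (x + e' *: (y - x)) - b = u + e' * v.
    by rewrite dotD dotZ addrAC.
  have [u0|u0] := eqVneq u 0.
    exists 1 => // e' _; rewrite uv -/u u0 add0r.
    rewrite /v dotD -scaleN1r dotZ mulN1r (hxy a b) //.
    - by move/eqP: u0; rewrite subr_eq0 => /eqP ->; rewrite subrr mulr0.
    - by apply: sH; rewrite inE hE eqxx.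
    - by move/eqP: u0; rewrite subr_eq0 => /eqP.
  have v1 : 0 < `|v| + 1 by rewrite ltr_wpDl.
  exists (`|u| / (`|v| + 1)); first by rewrite divr_gt0 ?normr_gt0.
  move=> e' /andP[e'0]; rewrite ler_pdivlMr // => e'u; rewrite uv -/u.
  have lt : `|e' * v| < `|u|.
    rewrite normrM (gtr0_norm e'0); apply: lt_le_trans e'u.
    by rewrite ltr_pM2l // ltrDl.
  have [ul|ul|/eqP] := ltgtP u 0; last by rewrite (negbTE u0).
  - rewrite (ltr0_sg ul) ltr0_sg //.
    move: lt; rewrite (ltr0_norm ul) ltr_norml => /andP[_].
    rewrite -[u in X in _ -> X]opprK addrC subr_lt0; exact.
  - rewrite (gtr0_sg ul) gtr0_sg //.
    move: lt; rewrite (gtr0_norm ul) ltr_norml => /andP[+ _].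
    by rewrite -subr_gt0 opprK addrC.
exists (Num.min e1 e2); first by rewrite lt_min e10.
move=> e' /andP[e'0]; rewrite le_min => /andP[le1 le2] a' b' a'0.
rewrite inE => /orP[/eqP hE'|]; last by apply: he1 => //; rewrite e'0.
have [c cE] := hyp_eqP a0 (etrans (esym hE) (esym hE')).
by rewrite !cE !sgrM (he2 e') // e'0.
Qed.

Lemma aff_hull_face H (F : face H) : aff_hull (fsval F) \in flats H.
Proof.
have /facesP[x ->] := valP F; apply/flatsP.
exists [fset h in H | `[< is_hyperplane h /\ h x >]]%fset.
  by apply/fsubsetP => h; rewrite !inE => /andP[].
apply/seteqP; split => y.
  move=> [k [p [c [Fp c1 ->]]]] h; rewrite /= !inE => /andP[hH /asboolP[]].
  move=> [a [a0 [b hE]]]; rewrite hE in hH *; rewrite /hyp/= dot_sum => xh.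
  rewrite -[RHS]mul1r -c1 mulr_suml; apply: eq_bigr => i _; congr (_ * _).
  apply/eqP; rewrite -subr_eq0 -sgr_eq0 -(Fp i _ _ a0 hH) xh subrr.
  by rewrite sgr_eq0.
move=> hy.
have [|e e0 he] := @small_move H x y.
  move=> a b a0 hH xh; apply: (hy (hyp a b)); rewrite /= !inE hH /=.
  by apply/asboolP; split => //; exists a; split => //; exists b.
exists 2, (fun i : 'I_2 => if val i == 0 then x else x + e *: (y - x)),
  (fun i : 'I_2 => if val i == 0 then 1 - e^-1 else e^-1); split.
- by move=> [[|i] hi] //=; exact: same_face_refl.
- by rewrite !big_ord_recl big_ord0 /= addr0 subrK.
rewrite !big_ord_recl big_ord0 /= addr0 scalerDr scalerA mulVf ?gt_eqF //.
by rewrite scale1r scalerBl scale1r addrA subrK addrC subrK.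
Qed.

Definition face_hull H (F : face H) : lattice H := [` aff_hull_face F]%fset.

(* The empty face does not belong to [ub_ideal H], so the value chosen for it
   (its affine hull when H is non-central) is irrelevant. *)
Definition z_ub H (q : Q H) : adjoin_min (lattice H) :=
  match q with
  | None => \top%O
  | Some t =>
    match val t : face_lattice H with
    | None => \bot%O
    | Some None => \top%O
    | Some (Some F) => Some (face_hull F)
    end
  end.

End Hyperplanes.

(* Main.v *)
Require Import Defs.
From mathcomp Require Import all_boot all_order all_algebra finmap.
From mathcomp Require Import all_classical all_reals topology normedtype.
From mathcomp Require Import ring lra zify.
Set Implicit Arguments.
Unset Strict Implicit.
Unset Printing Implicit Defensive.
Import Order.TTheory GRing.Theory Num.Theory.
Import numFieldNormedType.Exports.
Local Open Scope ring_scope.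

(** The fibres over a chain are counted from the top down: the last proper
    element is an unbounded face with affine hull [x_(k-1)], and each further
    element is a face with prescribed hull [X] having a given face [G] in its
    closure.  Both numbers come from Euler relations by Moebius inversion over
    the flats.  Cutting a relatively open convex set by a hyperplane that
    properly meets it replaces [(-1)^d] by [2 (-1)^d - (-1)^d], so the sum of
    [(-1)^dim F] over the faces [F] contained in a flat [X] is [(-1)^dim X].
    Being adherent to a point and, for sets without lines, containing a ray are
    compatible with such cuts; hence the faces of [X] adherent to a point of [X]
    also contribute [(-1)^dim X].  For the unbounded faces, first cut [X] only
    by the hyperplanes through a vertex [x0]: every cell but [{x0}] contains a
    ray, and cutting further preserves the sum, which is [(-1)^dim X - 1]. *)

(** * Moebius functions, ranks and chains *)

Section Mobius.
Context {d : Order.disp_t} {P : finPOrderType d}.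
Implicit Types x y z : P.

(** A property survives a cut if as many of the two open pieces have it as of the pair formed by the
    zero piece and the whole set. Containing a ray fails this for a line cut at a point: both
    half-lines have a ray, the point has none. Rays can therefore be counted only in sets without
    lines, which forces the passage through a vertex; essentiality provides one. Inverting
    [(-1)^dim W] over the flats [W] of an interval yields [Z], because ranks of nonempty flats are
    differences of dimensions. The summand -1 in the unbounded case runs over the nonempty flats
    only, and their Moebius values add up to [- mobius X \top]. Together with the vanishing term at
    the empty flat this subtracts [Zb] twice, hence [Zub]. Going down in [Q] from a face [G] means
    passing to faces whose closure contains [G]. These are unbounded as soon as [G] is, so the
    number of choices depends on [G] only through its hull. The minimum of [Q] is below everything,
    so the step from [x_0] to [x_1] contributes 1 and the product starts at 2. *)

Lemma sum_mobius x y :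
  \sum_(z : P | (x <= z)%O && (z <= y)%O) mobius x z = (x == y)%:R.
Proof.
have [->|nxy] := eqVneq x y.
  rewrite (big_pred1 y) ?mobius_xx // => z.
  by rewrite /= eq_sym eq_le.
have [xy|xy] := boolP (x <= y)%O; last first.
  rewrite big_pred0 // => z; apply/negbTE; apply: contra xy => /andP[].
  exact: le_trans.
have ltxy : (x < y)%O by rewrite lt_neqAle nxy.
rewrite (bigD1 y) /=; last by rewrite xy lexx.
rewrite (mobius_lt ltxy) addrC; apply/eqP; rewrite subr_eq0; apply/eqP.
by apply: eq_bigl => z; rewrite -andbA [(z < y)%O]lt_neqAle [(z != y) && _]andbC.
Qed.

(** After exchanging the sums, [g u] has coefficient [mobius x z] summed over [[x, u]], which is 1
    for [u = x] and 0 otherwise. The sums stop at [y], so everything stays in the interval over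
    which [Z] ranges. *)
Lemma mobius_inversion x y (g h : P -> int) :
  (x <= y)%O ->
  (forall z, (x <= z)%O -> (z <= y)%O ->
     \sum_(u : P | (z <= u)%O && (u <= y)%O) g u = h z) ->
  \sum_(z : P | (x <= z)%O && (z <= y)%O) mobius x z * h z = g x.
Proof.
move=> xy gh.
transitivity (\sum_(z : P | (x <= z)%O && (z <= y)%O)
    \sum_(u : P | (x <= u)%O && (u <= y)%O) (z <= u)%O%:R * (mobius x z * g u)).
  apply: eq_bigr => z /andP[xz zy]; rewrite -gh // mulr_sumr big_mkcond.
  rewrite [RHS]big_mkcond; apply: eq_bigr => u _.
  case zu: (z <= u)%O => /=; last by rewrite mul0r if_same.
  by rewrite (le_trans xz zu) mul1r.
rewrite exchange_big /=.
transitivity (\sum_(u : P | (x <= u)%O && (u <= y)%O) (x == u)%:R * g u).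
  apply: eq_bigr => u /andP[xu uy]; rewrite -sum_mobius mulr_suml big_mkcond.
  rewrite [RHS]big_mkcond; apply: eq_bigr => z _.
  case xz: (x <= z)%O => //=; case zu: (z <= u)%O => /=.
    by rewrite (le_trans zu uy) mul1r.
  by rewrite mul0r if_same.
rewrite (bigD1 x) /= ?lexx ?xy // eqxx mul1r big1 ?addr0 // => u /andP[_].
by rewrite eq_sym => /negbTE ->; rewrite mul0r.
Qed.

(** [del] is injective on a chain of [[x, y]] with values between [del y] and [del x], which bounds
    its size; climbing one level of [del] at a time attains the bound. *)
Lemma rank_eq_diff (del : P -> nat) x y :
  (forall z u, (x <= z)%O -> (z < u)%O -> (u <= y)%O -> (del u < del z)%N) ->
  (forall z, (x <= z)%O -> (z < y)%O ->
     exists u, [/\ (z < u)%O, (u <= y)%O & del z = (del u).+1]) ->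
  (x <= y)%O -> rank x y = (del x - del y)%N.
Proof.
move=> anti cov xy; apply/eqP; rewrite eqn_leq; apply/andP; split.
  apply/bigmax_leqP => C /andP[/forallP Cxy /forallP Ccmp].
  have {}Cxy u : u \in C -> (x <= u)%O && (u <= y)%O.
    by move=> uC; move: (Cxy u); rewrite uC.
  have delle u : u \in C -> (del y <= del u)%N && (del u <= del x)%N.
    move=> /Cxy /andP[xu uy]; apply/andP; split.
      have [->//|nuy] := eqVneq u y; apply/ltnW/anti => //.
      by rewrite lt_neqAle nuy.
    have [->//|nux] := eqVneq x u; apply/ltnW/anti => //.
    by rewrite lt_neqAle nux.
  have inj : {in C &, injective del}.
    move=> u v uC vC e; have /andP[xu uy] := Cxy _ uC; have /andP[xv vy] := Cxy _ vC.
    move: (Ccmp u); rewrite uC => /forallP/(_ v); rewrite vC /= => /orP[].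
      rewrite le_eqVlt => /orP[/eqP//|uv]; move: (anti _ _ xu uv vy).
      by rewrite e ltnn.
    rewrite le_eqVlt => /orP[/eqP//|uv]; move: (anti _ _ xv uv uy).
    by rewrite e ltnn.
  have: (size [seq del u | u <- enum C] <= size (iota (del y) (del x - del y).+1))%N.
    apply: uniq_leq_size.
      rewrite map_inj_in_uniq ?enum_uniq // => u v; rewrite !mem_enum; exact: inj.
    move=> j /mapP[u]; rewrite mem_enum => /delle /andP[h1 h2] ->.
    rewrite mem_iota; lia.
  rewrite size_map size_iota -cardE; lia.
(* Lower bound: [y] is fixed and [x] varies. A chain from [x] is a chain from some [u] one level up,
   with [x] added. *)
suff H : forall e x, (del x - del y)%N = e ->
   (forall z, (x <= z)%O -> (z < y)%O ->
     exists u, [/\ (z < u)%O, (u <= y)%O & del z = (del u).+1]) ->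
   (forall z u, (x <= z)%O -> (z < u)%O -> (u <= y)%O -> (del u < del z)%N) ->
   (x <= y)%O -> exists C : {set P}, [/\
      [forall u in C, (x <= u)%O && (u <= y)%O] &&
      [forall u in C, forall v in C, (u >=< v)%O], x \in C & #|C| = e.+1].
  have [C [hC _ cC]] := H _ _ erefl cov anti xy.
  rewrite /rank; apply: leq_trans (leq_bigmax_cond (F := fun C : {set P} => #|C|.-1) _ hC).
  by rewrite cC.
clear cov anti xy x; move=> e; elim: e => [|e IH] x De cov anti xy.
  exists [set x]; split; rewrite ?set11 ?cards1 //; apply/andP; split.
    by apply/forallP => u; apply/implyP; rewrite inE => /eqP ->; rewrite lexx.
  apply/forallP => u; apply/implyP; rewrite inE => /eqP ->.
  by apply/forallP => v; apply/implyP; rewrite inE => /eqP ->; rewrite comparablexx.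
have ltxy : (x < y)%O.
  by rewrite lt_neqAle xy andbT; apply/eqP => exy; move: De; rewrite exy subnn.
have [u [xu uy du]] := cov _ (lexx _) ltxy.
have [||||C [/andP[/forallP C1 /forallP C2] uC cC]] := IH u.
- lia.
- by move=> z uz; apply: cov; exact: le_trans (ltW xu) uz.
- by move=> z v uz; apply: anti; exact: le_trans (ltW xu) uz.
- exact: uy.
have xv v : v \in C -> (x < v)%O && (v <= y)%O.
  move=> vC; move: (C1 v); rewrite vC /= => /andP[uv ->].
  by rewrite (lt_le_trans xu uv).
exists (x |: C); split; last 2 first.
- by rewrite setU11.
- by rewrite cardsU1 cC; case: (boolP (x \in C)) => // /xv; rewrite ltxx.
apply/andP; split.
  apply/forallP => v; apply/implyP; rewrite !inE => /orP[/eqP->|/xv].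
    by rewrite lexx.
  by move=> /andP[/ltW -> ->].
apply/forallP => v; apply/implyP; rewrite !inE => vC.
apply/forallP => z; apply/implyP; rewrite !inE => zC.
case/orP: vC => [/eqP->|vC]; case/orP: zC => [/eqP->|zC].
- by rewrite comparablexx.
- by rewrite /Order.comparable; case/andP: (xv _ zC) => /ltW ->.
- by rewrite /Order.comparable; case/andP: (xv _ vC) => /ltW ->; rewrite orbT.
by move: (C2 v); rewrite vC /= => /forallP/(_ z); rewrite zC.
Qed.

End Mobius.

(** * Counting sequences through prescribed fibres *)

Section Chains.
Context {T : finType}.

Definition fcons m (t : T) (y : {ffun 'I_m -> T}) : {ffun 'I_m.+1 -> T} :=
  [ffun i => oapp y t (unlift ord0 i)].

Lemma fcons0 m t (y : {ffun 'I_m -> T}) : fcons t y ord0 = t.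
Proof. by rewrite ffunE unlift_none. Qed.

Lemma fconsS m t (y : {ffun 'I_m -> T}) i : fcons t y (lift ord0 i) = y i.
Proof. by rewrite ffunE liftK. Qed.

Lemma fcons_bij m : bijective (fun p : T * {ffun 'I_m -> T} => fcons p.1 p.2).
Proof.
exists (fun y : {ffun 'I_m.+1 -> T} => (y ord0, [ffun i => y (lift ord0 i)])).
  move=> [t y] /=; rewrite fcons0; congr pair; apply/ffunP => i.
  by rewrite ffunE fconsS.
move=> y; apply/ffunP => i /=; case: (unliftP ord0 i) => [j|] ->.
  by rewrite fconsS ffunE.
by rewrite fcons0.
Qed.

(** The hypothesis makes the number of predecessors of [t] in fibre [i] independent of [t].
    Splitting off the bottom entry therefore contributes the constant factor [c ord0] for every
    choice of the remaining entries. *)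
Lemma count_chains (r : rel T) m (A : 'I_m.+1 -> pred T) (c : 'I_m -> int) :
  (forall (i : 'I_m) t, A (lift ord0 i) t ->
     (#|[pred s | A (widen_ord (leqnSn m) i) s && r s t]|)%:Z = c i) ->
  (#|[pred y : {ffun 'I_m.+1 -> T} | [forall i, A i (y i)] &&
     [forall i : 'I_m, r (y (widen_ord (leqnSn m) i)) (y (lift ord0 i))]]|)%:Z
  = (\prod_(i < m) c i) * (#|A ord_max|)%:Z.
Proof.
elim: m A c => [|m IH] A c hc.
  rewrite big_ord0 mul1r; congr Posz; rewrite -!sum1_card.
  rewrite (reindex _ (onW_bij _ (fcons_bij 0))) /=.
  rewrite (_ : ord_max = ord0); last exact/val_inj.
  rewrite (eq_bigl (fun p => A ord0 p.1 && true)); last first.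
    move=> [t y] /=; rewrite !inE /= andbT; apply/andP/idP => [[/forallP/(_ ord0)]|At].
      by rewrite fcons0.
    split; last by apply/forallP => -[].
    by apply/forallP => i; case: (unliftP ord0 i) => [[]//|->]; rewrite fcons0.
  rewrite -(pair_big_dep (fun t => A ord0 t) (fun _ _ => true) (fun _ _ => 1%N)) /=.
  by apply: eq_bigr => t _; rewrite sum1_card card_ffun card_ord expn0.
rewrite big_ord_recl -mulrA.
rewrite (_ : ord_max = lift ord0 ord_max :> 'I_m.+2); last exact/val_inj.
set A' := fun i => A (lift ord0 i).
have -> : A (lift ord0 ord_max) = A' ord_max by [].
rewrite -(IH A' (fun i => c (lift ord0 i))); last first.
  move=> i t At; rewrite -(hc (lift ord0 i) t) //; congr Posz.
  by apply: eq_card => s;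
    rewrite !inE /A' (_ : lift ord0 _ = widen_ord (leqnSn m.+1) (lift ord0 i)) //;
      exact/val_inj.
rewrite -!sum1_card (reindex _ (onW_bij _ (fcons_bij m.+1))) /=.
set B := fun y : {ffun 'I_m.+1 -> T} => [forall i, A' i (y i)] &&
     [forall i : 'I_m, r (y (widen_ord (leqnSn m) i)) (y (lift ord0 i))].
rewrite (eq_bigl (fun p => B p.2 && (A ord0 p.1 && r p.1 (p.2 ord0)))); last first.
  move=> [t y] /=; rewrite !inE /= /B; apply/andP/idP.
    move=> [/forallP h1 /forallP h2]; apply/andP; split; first apply/andP; first split.
    - by apply/forallP => i; move: (h1 (lift ord0 i)); rewrite fconsS.
    - apply/forallP => i; move: (h2 (lift ord0 i)); rewrite fconsS.
      by rewrite (_ : widen_ord _ _ = lift ord0 (widen_ord (leqnSn m) i)) ?fconsS //;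
        exact/val_inj.
    - move: (h1 ord0) (h2 ord0); rewrite fconsS.
      by rewrite (_ : widen_ord _ _ = ord0) ?fcons0; [move=> -> ->|exact/val_inj].
  move=> /andP[/andP[/forallP h1 /forallP h2] /andP[h3 h4]]; split.
    by apply/forallP => i; case: (unliftP ord0 i) => [j|] ->; rewrite ?fcons0 ?fconsS //;
      exact: h1.
  apply/forallP => i; rewrite fconsS; case: (unliftP ord0 i) => [j|] ->.
    by rewrite (_ : widen_ord _ _ = lift ord0 (widen_ord (leqnSn m) j)) ?fconsS;
      [exact: h2|exact/val_inj].
  by rewrite (_ : widen_ord _ _ = ord0) ?fcons0 //; exact/val_inj.
(* The pair is swapped to make the tail the outer index: the inner sum then counts the bottom
   entries below a fixed tail. *)
rewrite -(reindex (fun p : T * {ffun 'I_m.+1 -> T} => (p.2, p.1)) (P :=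
  fun p => B p.1 && (A ord0 p.2 && r p.2 (p.1 ord0))) (F := fun _ => 1%N)) /=; last first.
  by apply: onW_bij; exists (fun p => (p.2, p.1)) => -[].
rewrite -(pair_big_dep B (fun y t => A ord0 t && r t (y ord0)) (fun _ _ => 1%N)) /=.
rewrite (big_morph Posz PoszD (id1 := 0%N)) //= [in RHS](big_morph Posz PoszD (id1 :=
  0%N)) //= mulr_sumr.
apply: eq_bigr => y /andP[/forallP h1 _]; rewrite sum1_card mulr1 -(hc ord0 _ (h1 ord0)).
congr Posz; apply: eq_card => s; rewrite !inE /=.
by rewrite (_ : widen_ord _ _ = ord0) //; exact/val_inj.
Qed.

End Chains.

(** * Relatively open convex sets *)

Section Signs.
Context {R : realType}.
Implicit Types p q t : R.

Lemma sgr_cases p : [\/ p < 0 /\ Num.sg p = -1, p = 0 /\ Num.sg p = 0 |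
  0 < p /\ Num.sg p = 1].
Proof.
case: (ltgtP p 0) => h.
- by constructor 1; rewrite ltr0_sg.
- by constructor 3; rewrite gtr0_sg.
- by constructor 2; rewrite h sgr0.
Qed.

Lemma sgr_ltnorm p q : `|q| < `|p| -> Num.sg (p + q) = Num.sg p.
Proof.
have [[h ->]|[-> _]|[h ->]] := sgr_cases p.
- rewrite (ltr0_norm h) => /ltr_normlP [h1 h2]; rewrite ltr0_sg //; lra.
- by rewrite normr0 normr_lt0.
- rewrite (gtr0_norm h) => /ltr_normlP [h1 h2]; rewrite gtr0_sg //; lra.
Qed.

Lemma sgr_conv p q t : Num.sg q = Num.sg p -> 0 <= t -> t <= 1 ->
  Num.sg (p + t * (q - p)) = Num.sg p.
Proof.
have [[h ->]|[-> ->]|[h ->]] := sgr_cases p.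
- move=> /eqP; rewrite sgr_cp0 => q0 t0 t1; rewrite ltr0_sg //; nra.
- by move=> /eqP; rewrite sgr_cp0 => /eqP -> _ _; rewrite subrr mulr0 addr0 sgr0.
- move=> /eqP; rewrite sgr_cp0 => q0 t0 t1; rewrite gtr0_sg //; nra.
Qed.

Lemma sgr_stable p q : p != 0 ->
  exists2 e : R, 0 < e & forall t, 0 <= t -> t <= e ->
    Num.sg (p + t * q) = Num.sg p.
Proof.
move=> p0; exists (`|p| / (`|q| + 1)).
  by rewrite divr_gt0 ?normr_gt0 // ltr_wpDl.
move=> t t0 te; apply: sgr_ltnorm; rewrite normrM (ger0_norm t0).
have q1 : 0 < `|q| + 1 by rewrite ltr_wpDl.
move: te; rewrite ler_pdivlMr // => te.
have := normr_gt0 p; rewrite p0 => p1; have := normr_ge0 q; nra.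
Qed.

Fixpoint signs m : seq (seq R) :=
  if m is m'.+1 then [seq c :: s | c <- [:: -1; 0; 1], s <- signs m'] else [:: [::]].

Lemma m1_neq0 : (-1 : R) != 0. Proof. by rewrite oppr_eq0 oner_eq0. Qed.

Lemma m1_neq1 : (-1 : R) != 1. Proof. by rewrite lt_eqF //; lra. Qed.

Lemma signsS m :
  signs m.+1 = [seq c :: s | c <- [:: -1; 0; 1], s <- signs m].
Proof. by []. Qed.

Lemma signs_uniq m : uniq (signs m).
Proof.
elim: m => [//|m IH]; apply: allpairs_uniq => //.
  by rewrite /= !inE !negb_or m1_neq0 m1_neq1 eq_sym oner_eq0.
by move=> [a s] [b t] _ _ [-> ->].
Qed.

Lemma mem_signs (T : Type) (g : T -> R) (fs : seq T) :
  [seq Num.sg (g f) | f <- fs] \in signs (size fs).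
Proof.
elim: fs => [//|f fs IH]; rewrite [map _ _]/=; apply/allpairsP.
exists (Num.sg (g f), [seq Num.sg (g f) | f <- fs]); split => //=.
rewrite !inE; have [[_ ->]|[_ ->]|[_ ->]] := sgr_cases (g f);
  by rewrite eqxx ?orbT.
Qed.

End Signs.

Section Geometry.
Context {R : realType} {n : nat}.
Local Notation V := 'rV[R]_n.
Local Open Scope classical_set_scope.
Implicit Types (f : V * R) (C X : set V) (U : 'M[R]_n) (P : set V -> Prop).

Definition ev f (x : V) : R := dot f.1 x - f.2.
Definition sgn f (x : V) : R := Num.sg (ev f x).

Lemma dot0 (a : V) : dot a 0 = 0.
Proof. by rewrite -(scale0r (0 : V)) dotZ mul0r. Qed.

Lemma dotN (a x : V) : dot a (- x) = - dot a x.
Proof. by rewrite -scaleN1r dotZ mulN1r. Qed.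

Lemma dotC (a x : V) : dot a x = dot x a.
Proof. by apply: eq_bigr => i _; rewrite mulrC. Qed.

Lemma dot_mx (a x : V) : x *m a^T = (dot a x)%:M.
Proof.
apply/matrixP => i j; rewrite !ord1 !mxE mulr1n.
by apply: eq_bigr => k _; rewrite !mxE mulrC.
Qed.

Lemma evD f x v t : ev f (x + t *: v) = ev f x + t * dot f.1 v.
Proof. by rewrite /ev dotD dotZ addrAC. Qed.

Lemma evB f x y : dot f.1 (y - x) = ev f y - ev f x.
Proof. by rewrite /ev dotD dotN; ring. Qed.

Lemma ev_seg f x y t : ev f (x + t *: (y - x)) = ev f x + t * (ev f y - ev f x).
Proof. by rewrite evD evB. Qed.

(* A relatively open convex set, with [U] the direction of its affine hull;
   relative openness is only required along segments. *)
Definition relopen U C : Prop :=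
  [/\ C !=set0,
      forall x y t, C x -> C y -> 0 <= t -> t <= 1 -> C (x + t *: (y - x)),
      forall x y, C x -> C y -> (y - x <= U)%MS &
      forall x u, C x -> (u <= U)%MS ->
        exists2 e : R, 0 < e & forall t, 0 <= t -> t <= e -> C (x + t *: u)].

(** [C] determines [U] only up to its row space, so just the rank is kept. A set without such a [U],
    like the empty one, gets the default 0; [weight] (for properties false of the empty set) and
    [height] deal with emptiness separately. *)
Definition adim C : nat := \rank (xget 0 [set U : 'M[R]_n | relopen U C]).

Lemma relopen_sub U U' C C' : relopen U C -> relopen U' C' -> C `<=` C' ->
  (U <= U')%MS.
Proof.
move=> [[x Cx] _ _ op] [_ _ dif' _] CC'; apply/rV_subP => u uU.
have [e e0 he] := op _ _ Cx uU.
have := dif' _ _ (CC' _ Cx) (CC' _ (he e (ltW e0) (lexx e))).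
rewrite addrC addKr => /(scalemx_sub e^-1).
by rewrite scalerA mulVf ?gt_eqF // scale1r.
Qed.

Lemma adimE U C : relopen U C -> adim C = \rank U.
Proof.
move=> gU; rewrite /adim; case: xgetP => [U' _ gU'|/(_ U)//].
apply/eqP; rewrite eqn_leq; apply/andP; split; apply: mxrankS;
  [exact: (relopen_sub gU' gU)|exact: (relopen_sub gU gU')].
Qed.

Lemma relopenT : relopen 1%:M [set: V].
Proof.
split => //; first by exists 0.
  by move=> x y _ _; exact: submx1.
by move=> x u _ _; exists 1.
Qed.

Definition piece f c C : set V := C `&` [set x | sgn f x = c].

Lemma sgn_cases f x : [\/ ev f x < 0 /\ sgn f x = -1, ev f x = 0 /\ sgn f x = 0 |
  0 < ev f x /\ sgn f x = 1].
Proof. exact: sgr_cases. Qed.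

Lemma pieceE f c C : (forall x, C x -> sgn f x = c) -> piece f c C = C.
Proof. by move=> h; apply/seteqP; split => x //= => [[]//|Cx]; split => //; exact: h. Qed.

Lemma sgn_seg f x y t : sgn f y = sgn f x -> 0 <= t -> t <= 1 ->
  sgn f (x + t *: (y - x)) = sgn f x.
Proof. by move=> xy t0 t1; rewrite /sgn ev_seg; exact: sgr_conv. Qed.

Lemma relopen_piece U C f c : relopen U C -> c != 0 -> piece f c C !=set0 ->
  relopen U (piece f c C).
Proof.
move=> [_ cv dif op] c0 ne; split => //.
- move=> x y t [Cx xc] [Cy yc] t0 t1; split; first exact: cv.
  by rewrite /= sgn_seg // yc xc.
- by move=> x y [Cx _] [Cy _]; exact: dif.
move=> x u [Cx xc] uU; have [e e0 he] := op _ _ Cx uU.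
have [|e' e'0 he'] := @sgr_stable _ (ev f x) (dot f.1 u).
  by apply: contra c0; rewrite -xc /sgn sgr_eq0.
exists (Num.min e e'); first by rewrite lt_min e0.
move=> t t0; rewrite le_min => /andP[te te']; split; first exact: he.
by rewrite /= /sgn evD he'.
Qed.

Lemma relopen_piece0 U C f : relopen U C -> piece f 0 C !=set0 ->
  relopen (U :&: kermx f.1^T)%MS (piece f 0 C).
Proof.
have sE x : sgn f x = 0 <-> ev f x = 0.
  by rewrite /sgn; split=> [/eqP|->]; [rewrite sgr_eq0 => /eqP|rewrite sgr0].
move=> [_ cv dif op] ne; split => //.
- move=> x y t [Cx xc] [Cy yc] t0 t1; split; first exact: cv.
  by rewrite /= sgn_seg // yc xc.
- move=> x y [Cx xc] [Cy yc]; rewrite sub_capmx dif //= sub_kermx dot_mx evB.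
  by move/sE: xc => ->; move/sE: yc => ->; rewrite subrr raddf0.
move=> x u [Cx xc]; rewrite sub_capmx => /andP[uU uk].
have [e e0 he] := op _ _ Cx uU; exists e => // t t0 te; split; first exact: he.
apply/sE; move/sE: xc => xc; rewrite evD xc add0r.
move: uk; rewrite sub_kermx dot_mx => /eqP/matrixP/(_ 0 0).
by rewrite !mxE mulr1n => ->; rewrite mulr0.
Qed.

Lemma piece_relopen U C f c : relopen U C ->
  piece f c C = set0 \/ exists U', relopen U' (piece f c C).
Proof.
move=> gC; have [->|/set0P ne] := eqVneq (piece f c C) set0; first by left.
right; have [c0|c0] := eqVneq c 0; last by exists U; exact: relopen_piece.
by exists (U :&: kermx f.1^T)%MS; rewrite c0 in ne *; exact: relopen_piece0.
Qed.

(** Rank-nullity for the functional [dot a] on [U], whose image is a nonzero subspace of a line. *)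
Lemma rank_cap_ker U (a u : V) : (u <= U)%MS -> dot a u != 0 ->
  (\rank (U :&: kermx a^T)%MS).+1 = \rank U.
Proof.
move=> uU au; rewrite -(mxrank_mul_ker U a^T) -add1n; congr (_ + _)%N.
apply/eqP; rewrite eq_sym eqn_leq rank_leq_col lt0n mxrank_eq0.
apply: contra au => /eqP Ua; have /submxP[D uE] := uU.
have := dot_mx a u; rewrite uE -mulmxA Ua mulmx0 => /matrixP/(_ 0 0).
by rewrite !mxE mulr1n => <-.
Qed.

(** If [f] vanishes at [z] but not at [x], relative openness prolongs the segment from [x] slightly
    beyond [z], where [f] has the opposite sign ([ext]). So a non-constant sign takes both strict
    values. *)
Lemma sgn_dichotomy U C f : relopen U C ->
  (exists c, forall x, C x -> sgn f x = c) \/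
  (exists x y, [/\ C x, C y, ev f x < 0 & 0 < ev f y]).
Proof.
move=> [[x0 Cx0] cv dif op].
have [h|] := pselect (forall x, C x -> sgn f x = sgn f x0); first by left;
  exists (sgn f x0).
move=> /existsNP[x1 /not_implyP[Cx1 ne]]; right.
have ext x z : C x -> C z -> ev f z = 0 -> exists y, C y /\ exists2 e : R,
    0 < e & ev f y = - (e * ev f x).
  move=> Cx Cz z0; have [e e0 he] := op _ _ Cz (dif _ _ Cx Cz).
  exists (z + e *: (z - x)); split; first by apply: he => //; exact: ltW.
  by exists e => //; rewrite evD evB z0; ring.
have [[a ea]|[a ea]|[a ea]] := sgn_cases f x0;
have [[b eb]|[b eb]|[b eb]] := sgn_cases f x1; rewrite ?ea ?eb // in ne.
- have [y [Cy [e e0 ye]]] := ext _ _ Cx0 Cx1 b; exists x0, y; split => //; nra.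
- by exists x0, x1.
- have [y [Cy [e e0 ye]]] := ext _ _ Cx1 Cx0 a; exists x1, y; split => //; nra.
- have [y [Cy [e e0 ye]]] := ext _ _ Cx1 Cx0 a; exists y, x1; split => //; nra.
- by exists x1, x0.
- have [y [Cy [e e0 ye]]] := ext _ _ Cx0 Cx1 b; exists y, x0; split => //; nra.
Qed.

Definition weight P C : int := if `[< P C >] then (-1) ^+ adim C else 0.

(** The open pieces have the dimension [d] of [C] and the zero piece has dimension [d - 1].
    Multiplied by [(-1)^d], this identity says that the weights of the three pieces add up to that
    of [C]; moving the zero piece to the right avoids subtraction. *)
Definition splits P C : Prop := forall f x y, C x -> C y -> ev f x < 0 -> 0 < ev f y ->
  (`[< P (piece f (-1) C) >] + `[< P (piece f 1 C) >] =
   `[< P (piece f 0 C) >] + `[< P C >])%N.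

Lemma straddle_zero U C f x y : relopen U C -> C x -> C y -> ev f x < 0 -> 0 < ev f y ->
  exists2 z, C z & ev f z = 0.
Proof.
move=> [_ cv _ _] Cx Cy x0 y0.
have d0 : 0 < ev f y - ev f x by lra.
exists (x + (- ev f x / (ev f y - ev f x)) *: (y - x)).
  apply: cv => //; first by rewrite divr_ge0 //; lra.
  by rewrite ler_pdivrMr //; lra.
by rewrite ev_seg divfK ?gt_eqF // subrr.
Qed.

Lemma weight0 P : ~ P set0 -> weight P set0 = 0.
Proof. by move=> P0; rewrite /weight asboolF. Qed.

Lemma weight_split P U C f : ~ P set0 -> relopen U C -> splits P C ->
  \sum_(c <- [:: -1; 0; 1]) weight P (piece f c C) = weight P C.
Proof.
move=> P0 gC sP; rewrite !big_cons big_nil addr0.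
have [[c hc]|[x [y [Cx Cy x0 y0]]]] := sgn_dichotomy f gC.
  have emp c' : c' != c -> piece f c' C = set0.
    move=> c'c; apply/seteqP; split => // z [Cz /= zc'].
    by move: c'c; rewrite -zc' hc // eqxx.
  have [[z Cz] _ _ _] := gC; have zc := hc _ Cz.
  have N1 := @m1_neq1 R; have N0 := @m1_neq0 R.
  have [[_ e]|[_ e]|[_ e]] := sgn_cases f z; rewrite zc in e; rewrite e in hc emp.
  - by rewrite (pieceE hc) !emp ?weight0 ?addr0 // eq_sym ?m1_neq0 ?m1_neq1.
  - by rewrite (pieceE hc) !emp ?weight0 ?addr0 ?add0r // ?oner_eq0.
  - by rewrite (pieceE hc) !emp ?weight0 ?addr0 ?add0r // eq_sym oner_eq0.
have s1 : sgn f y = 1 by rewrite /sgn gtr0_sg.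
have sm : sgn f x = -1 by rewrite /sgn ltr0_sg.
have [z Cz z0] := straddle_zero gC Cx Cy x0 y0.
have sz : sgn f z = 0 by rewrite /sgn z0 sgr0.
have := sP _ _ _ Cx Cy x0 y0; rewrite /weight.
rewrite (adimE (relopen_piece gC (@m1_neq0 R) (f := f) _)); last by exists x.
rewrite (adimE (relopen_piece gC (oner_neq0 _) (f := f) _)); last by exists y.
rewrite (adimE (relopen_piece0 gC (f := f) _)); last by exists z.
rewrite (adimE gC).
have [_ _ dif _] := gC; have uU := dif _ _ Cx Cy.
have du : dot f.1 (y - x) != 0 by rewrite evB gt_eqF //; lra.
rewrite -(rank_cap_ker uU du) exprS mulN1r.
(* [q] is the sign of the zero piece; the open pieces and [C] carry [-q]. What remains is a check of
   the truth values that [splits] admits. *)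
move: ((-1) ^+ _) => q; by do 4! case: `[< _ >] => //=; move=> _; ring.
Qed.

(** * Sign cells and the Euler relation *)

Definition cell (fs : seq (V * R)) C s : set V :=
  C `&` [set x | [seq sgn f x | f <- fs] = s].

Lemma cell_cons f fs C c s : cell (f :: fs) C (c :: s) = cell fs (piece f c C) s.
Proof.
apply/seteqP; split => x /=.
  by move=> [Cx [xc xs]].
by move=> [[Cx xc] xs]; split => //=; rewrite xc xs.
Qed.

Lemma cell_nil C : cell [::] C [::] = C.
Proof. by apply/seteqP; split => x //= []. Qed.

Lemma cell_set0 fs s : cell fs set0 s = set0.
Proof. by apply/seteqP; split => x // []. Qed.

Lemma cell_relopen fs U C s : relopen U C ->
  cell fs C s = set0 \/ exists U', relopen U' (cell fs C s).
Proof.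
elim: fs U C s => [|f fs IH] U C [|c s] gC.
- by right; exists U; rewrite cell_nil.
- by left; apply/seteqP; split => x // [].
- by left; apply/seteqP; split => x // [].
rewrite cell_cons; have [->|[U' gU']] := piece_relopen f c gC; last exact: IH gU'.
by left; exact: cell_set0.
Qed.

(** Each cut preserves the total weight by [weight_split]. [K] is a hereditary condition under which
    [P] splits: vacuous for nonemptiness and adherence, [has_no_line] for rays. *)
Lemma euler_sum P (K : set V -> Prop) fs : ~ P set0 ->
  (forall C C', K C -> C' `<=` C -> K C') ->
  (forall U C, relopen U C -> K C -> splits P C) ->
  forall U C, relopen U C -> K C ->
  \sum_(s <- signs (size fs)) weight P (cell fs C s) = weight P C.
Proof.
move=> P0 Ksub sP; elim: fs => [|f fs IH] U C gC KC.
  by rewrite big_seq1 cell_nil.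
rewrite [size _]/= signsS big_allpairs_dep -(weight_split f P0 gC (sP _ _ gC KC)).
apply: eq_bigr => c _; under eq_bigr do rewrite cell_cons.
have [->|[U' gU']] := piece_relopen f c gC; last first.
  by apply: IH gU' _; apply: (Ksub C) => // x [].
by rewrite weight0 // big1 // => s _; rewrite cell_set0 weight0.
Qed.

Lemma splits_nonempty U C : relopen U C -> splits (fun C => C !=set0) C.
Proof.
move=> gC f x y Cx Cy x0 y0.
have [z Cz z0] := straddle_zero gC Cx Cy x0 y0.
have sz : sgn f z = 0 by rewrite /sgn z0 sgr0.
rewrite !asboolT //; first by exists x.
- by exists z.
- by exists y; split => //; rewrite /= /sgn gtr0_sg.
- by exists x; split => //; rewrite /= /sgn ltr0_sg.
Qed.

(* For relatively open convex [C] this is membership of [p] in the closure. *)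
Definition adherent (p : V) C : Prop :=
  exists2 y, C y & forall t, 0 < t -> t <= 1 -> C (p + t *: (y - p)).

(** Relative openness prolongs the segment from the witness [y] through [z] to a point [z'] of [C];
    convexity between [z'] and the segment from [p] to [y] then gives the segment from [p] to
    [z]. *)
Lemma adherent_all U C p z t : relopen U C -> adherent p C -> C z ->
  0 < t -> t <= 1 -> C (p + t *: (z - p)).
Proof.
move=> [_ cv dif op] [y Cy hy] Cz t0; rewrite le_eqVlt => /orP[/eqP->|t1].
  by rewrite scale1r addrC subrK.
have [d d0 hd] := op _ _ Cz (dif _ _ Cy Cz).
have Cz' := hd d (ltW d0) (lexx d).
have d1 : 0 < 1 + d by lra.
(* With [z' = z + d (z - y)], the point [p + t (z - p)] lies at parameter [t / (1 + d)] between
   [p + s (y - p)] and [z'] exactly for this [s]. *)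
pose s := t * d / (1 + d - t).
have s0 : 0 < s by rewrite /s divr_gt0 ?mulr_gt0 //; lra.
have s1 : s <= 1 by rewrite /s ler_pdivrMr; nra.
have := cv _ _ (t / (1 + d)) (hy s s0 s1) Cz'.
rewrite (_ : _ + _ = p + t *: (z - p)); first apply.
- by rewrite divr_ge0 //; lra.
- by rewrite ler_pdivrMr //; lra.
apply/rowP => i; rewrite !mxE /s; field.
by apply/andP; split; apply/eqP; lra.
Qed.

Lemma adherent_sub p C C' : C `<=` C' -> adherent p C -> adherent p C'.
Proof. by move=> CC' [y Cy hy]; exists y; [exact: CC'|move=> t t0 t1; apply/CC'/hy]. Qed.

(** If [f] vanishes at [p], adherence of [C] and of all three pieces is equivalent. Otherwise only
    the piece on the side of [p] can be adherent, and it is so exactly when [C] is. *)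
Lemma splits_adherent U C p : relopen U C -> splits (adherent p) C.
Proof.
move=> gC f x y Cx Cy x0 y0.
have [z Cz z0] := straddle_zero gC Cx Cy x0 y0.
have sz : sgn f z = 0 by rewrite /sgn z0 sgr0.
have sx : sgn f x = -1 by rewrite /sgn ltr0_sg.
have sy : sgn f y = 1 by rewrite /sgn gtr0_sg.
have sub c : adherent p (piece f c C) -> adherent p C.
  by apply: adherent_sub => ? [].
have keep u : C u -> sgn f u = sgn f p -> adherent p C -> adherent p (piece f (sgn f u) C).
  move=> Cu up ap; exists u => // t t0 t1; split; first exact: adherent_all gC ap Cu t0 t1.
  by rewrite /= sgn_seg // ltW.
have lose c : ev f p != 0 -> c != sgn f p -> ~ adherent p (piece f c C).
  move=> p0 cp [u _ hu]; have [e e0 he] := sgr_stable (dot f.1 (u - p)) p0.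
  have [||_ /=] := hu (Num.min e 1);
    [by rewrite lt_min e0 ltr01|by rewrite ge_min lexx orbT|].
  rewrite /sgn evD he; [|by rewrite ltW // lt_min e0 ltr01|by rewrite ge_min lexx].
  by move=> pc; rewrite -pc eqxx in cp.
have N1 := @m1_neq1 R; have N0 := @m1_neq0 R.
have [[a ea]|[a ea]|[a ea]] := sgn_cases f p.
- have p0 : ev f p != 0 by rewrite lt_eqF.
  rewrite (asboolF (lose 1 p0 _)) ?ea 1?eq_sym // (asboolF (lose 0 p0 _)) ?ea 1?eq_sym //.
  rewrite addn0 add0n; congr nat_of_bool; apply: asbool_equiv_eq; split; first exact: sub.
  by move=> ap; rewrite -sx; apply: keep => //; rewrite sx ea.
- have all u c : C u -> sgn f u = c -> adherent p C -> adherent p (piece f c C).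
    move=> Cu <- ap; exists u => // t t0 t1; split;
      first exact: adherent_all gC ap Cu t0 t1.
    by rewrite /= /sgn ev_seg a add0r subr0 sgrM gtr0_sg // mul1r.
  have eq u c : C u -> sgn f u = c -> `[< adherent p (piece f c C) >] = `[< adherent p C >].
    by move=> Cu uc; apply: asbool_equiv_eq; split; [exact: sub|exact: all uc].
  by rewrite (eq x) // (eq y) // (eq z).
- have p0 : ev f p != 0 by rewrite gt_eqF.
  rewrite (asboolF (lose (-1) p0 _)) ?ea // (asboolF (lose 0 p0 _)) ?ea 1?eq_sym
    ?oner_eq0 //.
  rewrite !add0n; congr nat_of_bool; apply: asbool_equiv_eq; split; first exact: sub.
  by move=> ap; rewrite -sy; apply: keep => //; rewrite sy ea.
Qed.

(** * Rays and lines *)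

Definition has_ray C : Prop :=
  exists x v, v != 0 /\ forall t, 0 <= t -> C (x + t *: v).

Definition has_no_line C : Prop :=
  forall x v, v != 0 -> ~ forall t, C (x + t *: v).

(** Prolonging the segment from [x] to [y] to some [y'] in [C] puts [y + t v] between [y'] and a
    point of the given ray. Relative openness matters: an open half-plane with one boundary point
    added is convex, but no ray along the boundary starts at that point. *)
Lemma ray_translate U C x y v t : relopen U C ->
  (forall t, 0 <= t -> C (x + t *: v)) -> C y -> 0 <= t -> C (y + t *: v).
Proof.
move=> [_ cv dif op] hx Cy t0.
have Cx : C x by have := hx 0 (lexx 0); rewrite scale0r addr0.
have [d d0 hd] := op _ _ Cy (dif _ _ Cx Cy).
have Cy' := hd d (ltW d0) (lexx d).
have d1 : 0 < 1 + d by lra.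
have := cv _ _ (d / (1 + d)) Cy' (hx (t * (1 + d) / d) _).
rewrite (_ : _ + _ *: (_ - _) = y + t *: v); first apply.
- by rewrite divr_ge0 ?mulr_ge0 //; lra.
- by rewrite divr_ge0 //; lra.
- by rewrite ler_pdivrMr //; lra.
apply/rowP => i; rewrite !mxE; field.
by apply/andP; split; apply/eqP; lra.
Qed.

(** A ray in the zero piece is parallel to [f = 0] and can be moved into both open pieces, so all
    four sets have one. Otherwise every ray of [C] is transversal to [f = 0], hence can be moved
    into one open piece, and [both] excludes rays in the two at once. *)
Lemma splits_ray U C : relopen U C -> has_no_line C -> splits has_ray C.
Proof.
move=> gC nl f x y Cx Cy x0 y0.
have [z Cz z0] := straddle_zero gC Cx Cy x0 y0.
have tr := ray_translate gC.
have sub c : has_ray (piece f c C) -> has_ray C.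
  by move=> [u [v [v0 hv]]]; exists u, v; split => // t /hv [].
have along v u : dot f.1 v = 0 -> C u -> (forall w t, C w -> 0 <= t -> C (w + t *: v)) ->
    forall t, 0 <= t -> piece f (sgn f u) C (u + t *: v).
  by move=> v0 Cu rv t t0; split; [exact: rv|rewrite /= /sgn evD v0 mulr0 addr0].
have sz : sgn f z = 0 by rewrite /sgn z0 sgr0.
have sx : sgn f x = -1 by rewrite /sgn ltr0_sg.
have sy : sgn f y = 1 by rewrite /sgn gtr0_sg.
have [r0|nr0] := pselect (has_ray (piece f 0 C)).
  rewrite !asboolT //; first exact: sub r0.
  - have [u [v [v0 hv]]] := r0; exists y, v; split => // t t0; rewrite -sy;
    apply: along => //.
      have [_ /eqP] := hv 0 (lexx 0); have [_ /eqP] := hv 1 ler01.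
      rewrite /sgn !sgr_eq0 !evD => /eqP e1 /eqP; lra.
    by move=> w s Cw s0; apply: (tr u) => // r r0'; have [] := hv r r0'.
  have [u [v [v0 hv]]] := r0; exists x, v; split => // t t0; rewrite -sx;
    apply: along => //.
    have [_ /eqP] := hv 0 (lexx 0); have [_ /eqP] := hv 1 ler01.
    rewrite /sgn !sgr_eq0 !evD => /eqP e1 /eqP; lra.
  by move=> w s Cw s0; apply: (tr u) => // r r0'; have [] := hv r r0'.
rewrite (asboolF nr0) add0n.
have [rC|nrC] := pselect (has_ray C); last first.
  by rewrite (asboolF nrC) !asboolF // => /sub.
rewrite (asboolT rC).
have nz v : v != 0 -> (forall w t, C w -> 0 <= t -> C (w + t *: v)) -> dot f.1 v != 0.
  move=> v0 rv; apply/eqP => dv; apply: nr0; exists z, v; split => //.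
  by move=> t t0; have := along v z dv Cz rv t t0; rewrite sz.
(* The positive combination [u] of the two directions is killed by [f]. If [u] is nonzero it
   contradicts [nz]; if [u = 0], then [w] is a negative multiple of [v] and [C] contains a line. *)
have both v w : v != 0 -> w != 0 -> (forall u t, C u -> 0 <= t -> C (u + t *: v)) ->
    (forall u t, C u -> 0 <= t -> C (u + t *: w)) -> 0 < dot f.1 v -> dot f.1 w < 0 ->
      False.
  move=> v0 w0 rv rw dv dw; pose u := dot f.1 v *: w - dot f.1 w *: v.
  have ru p t : C p -> 0 <= t -> C (p + t *: u).
    move=> Cp t0.
    have -> : p + t *: u = p + (t * dot f.1 v) *: w + (t * - dot f.1 w) *: v.
      by apply/rowP => i; rewrite /u !mxE; ring.
    apply: rv; last by rewrite mulr_ge0 //; lra.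
    by apply: rw => //; rewrite mulr_ge0 //; lra.
  have [u0|u0] := eqVneq u 0; last first.
    by move: (nz u u0 ru); rewrite /u dotD dotN !dotZ mulrC subrr eqxx.
  apply: (nl x v v0) => t; have [t0|/ltW t0] := leP 0 t; first exact: rv.
  have -> : x + t *: v = x + (t * dot f.1 v / dot f.1 w) *: w.
    congr (_ + _); move/eqP: u0; rewrite subr_eq0 => /eqP u0.
    rewrite -mulrA mulrC -mulrA [_^-1 * _]mulrC mulrC.
    have -> : t *: v = (t / dot f.1 w) *: (dot f.1 w *: v).
      by rewrite scalerA divfK // lt_eqF.
    by rewrite -u0 scalerA; congr (_ *: _); ring.
  apply: rw => //; rewrite -mulrA mulr_le0 // ltW // pmulr_rlt0 // invr_lt0 //.
have dirs u v c : v != 0 -> (forall t, 0 <= t -> piece f c C (u + t *: v)) ->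
    (forall w t, C w -> 0 <= t -> C (w + t *: v)) /\ dot f.1 v != 0.
  move=> v0 hv; have rv w t : C w -> 0 <= t -> C (w + t *: v).
    by move=> Cw t0; apply: (tr u) => // s /hv [].
  by split => //; exact: nz.
have dpos u v : v != 0 -> (forall t, 0 <= t -> piece f 1 C (u + t *: v)) -> 0 < dot f.1 v.
  move=> v0 hv; have [_ dv] := dirs _ _ _ v0 hv; rewrite lt_neqAle eq_sym dv leNgt /=.
  apply/negP => dn; have u0 : 0 < ev f u.
    by have [_ /eqP] := hv 0 (lexx 0); rewrite scale0r addr0 /sgn sgr_cp0.
  (* At this parameter the ray would meet [f = 0]. *)
  have [|_ /eqP] := hv (- ev f u / dot f.1 v).
    by rewrite mulNr -mulrN mulr_ge0 // ?ltW // oppr_gt0 invr_lt0.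
  by rewrite /sgn evD divfK // subrr sgr0 eq_sym oner_eq0.
have dneg u v : v != 0 -> (forall t, 0 <= t -> piece f (-1) C (u + t *: v)) ->
  dot f.1 v < 0.
  move=> v0 hv; have [_ dv] := dirs _ _ _ v0 hv; rewrite lt_neqAle dv leNgt /=.
  apply/negP => dn; have u0 : ev f u < 0.
    by have [_ /eqP] := hv 0 (lexx 0); rewrite scale0r addr0 /sgn sgr_cp0.
  have [|_ /eqP] := hv (- ev f u / dot f.1 v).
    by rewrite divr_ge0 // ltW // oppr_gt0.
  by rewrite /sgn evD divfK // subrr sgr0 eq_sym (negbTE m1_neq0).
have [p [v [v0 hv]]] := rC; have rv w t : C w -> 0 <= t -> C (w + t *: v) by move=> Cw;
  exact: (tr p).
have := nz v v0 rv; case: (ltgtP (dot f.1 v) 0) => // dv _.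
  rewrite asboolT; last first.
    exists x, v; split => // t t0; split; first exact: rv.
    rewrite /= /sgn ltr0_sg // evD; nra.
  rewrite asboolF // => -[u [w [w0 hw]]]; have [rw _] := dirs _ _ _ w0 hw.
  exact: (both w v w0 v0 rw rv (dpos _ _ w0 hw) dv).
rewrite addnC asboolT; last first.
  exists y, v; split => // t t0; split; first exact: rv.
  rewrite /= /sgn gtr0_sg // evD; nra.
rewrite asboolF // => -[u [w [w0 hw]]]; have [rw _] := dirs _ _ _ w0 hw.
exact: (both v w v0 w0 rv rw dv (dneg _ _ w0 hw)).
Qed.

End Geometry.

(** * Faces and flats *)

Section Arrangement.
Context {R : realType} {n : nat}.
Local Notation V := 'rV[R]_n.
Local Open Scope classical_set_scope.
Implicit Types (f : V * R) (C X : set V) (U : 'M[R]_n) (P : set V -> Prop)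
  (H : {fset set V}) (fs gs : seq (V * R)).

(** A hyperplane may have several equations in the list; [sum_ray] relies on this when it puts the
    equations vanishing at a vertex in front of the full list. *)
Definition represents H fs : Prop :=
  (forall f, f \in fs -> f.1 != 0) /\
  (forall h, h \in H <-> exists2 f, f \in fs & h = hyp f.1 f.2).

Lemma exists_represents H : (forall h, h \in H -> is_hyperplane h) ->
  exists fs, represents H fs.
Proof.
move=> Hh; pose rep (h : set V) : V * R :=
  xget (0, 0) [set ab : V * R | ab.1 != 0 /\ h = hyp ab.1 ab.2].
have repP h : h \in H -> (rep h).1 != 0 /\ h = hyp (rep h).1 (rep h).2.
  move=> /Hh [a [a0 [b hE]]]; rewrite /rep; case: xgetP => [ab _ //|].
  by move=> /(_ (a, b)) []; split.
exists [seq rep h | h <- enum_fset H]; split.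
  by move=> _ /mapP[h hH ->]; have [] := repP _ hH.
move=> h; split=> [hH|[_ /mapP[h' h'H ->] ->]].
  by exists (rep h); [exact: map_f|have [] := repP _ hH].
by have [_ <-] := repP _ h'H.
Qed.

Lemma same_faceE H fs x y : represents H fs ->
  same_face H x y <-> forall f, f \in fs -> sgn f x = sgn f y.
Proof.
move=> [f0 fH]; split=> [xy f ffs|xy a b a0 /fH [f ffs e]].
  by apply: xy; [exact: f0|apply/fH; exists f].
have [c cE] := hyp_eqP (f0 _ ffs) (esym e).
by rewrite !cE !sgrM; congr (_ * _); exact: xy.
Qed.

Lemma mapsgnE fs x y : (forall f, f \in fs -> sgn f x = sgn f y) <->
  [seq sgn f x | f <- fs] = [seq sgn f y | f <- fs].
Proof. by split=> [/eq_in_map|/eq_in_map]. Qed.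

Lemma cell_face H fs x : represents H fs ->
  cell fs setT [seq sgn f x | f <- fs] = [set y | same_face H x y].
Proof.
move=> rH; apply/seteqP; split => y /=.
  by move=> [_ /= e]; apply/(same_faceE _ _ rH)/mapsgnE.
by move=> /(same_faceE _ _ rH)/mapsgnE.
Qed.

Lemma face_rep H (F : face H) : exists x, val F x.
Proof. by have /facesP[x ->] := valP F; exists x. Qed.

Lemma faceE H (F : face H) x : val F x -> val F = [set y | same_face H x y].
Proof.
have /facesP[y ->] := valP F => yx; apply/seteqP; split => z /= h a b a0 hH.
  by rewrite -(yx _ _ a0 hH) h.
by rewrite (yx _ _ a0 hH) h.
Qed.

Lemma face_of_subproof H x : [set y | same_face H x y] \in faces H.
Proof. by apply/facesP; exists x. Qed.

Definition face_of H x : face H := [` face_of_subproof H x]%fset.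

Lemma face_sgn H fs (F : face H) x y f : represents H fs -> val F x -> val F y ->
  f \in fs -> sgn f x = sgn f y.
Proof.
by move=> rH Fx; rewrite (faceE Fx) => /(same_faceE _ _ rH) h /h.
Qed.

Lemma face_sgn_mem H fs (F : face H) x y : represents H fs -> val F x ->
  (forall f, f \in fs -> sgn f x = sgn f y) -> val F y.
Proof. by move=> rH Fx h; rewrite (faceE Fx); apply/(same_faceE _ _ rH). Qed.

Lemma face_relopen H fs (F : face H) : represents H fs ->
  exists U, relopen U (val F).
Proof.
move=> rH; have [x Fx] := face_rep F; rewrite (faceE Fx) -(cell_face _ rH).
have [e|//] := cell_relopen fs [seq sgn f x | f <- fs] (@relopenT R n).
by have : set0 x by rewrite -e.
Qed.

Definition zeros gs : set V := [set x | forall f, f \in gs -> ev f x = 0].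

Lemma sgn_eq0 f x : sgn f x = 0 <-> ev f x = 0.
Proof. by rewrite /sgn; split=> [/eqP|->]; [rewrite sgr_eq0 => /eqP|rewrite sgr0]. Qed.

Lemma zeros_relopen gs x : zeros gs x -> exists U, relopen U (zeros gs).
Proof.
move=> zx; have -> : zeros gs = cell gs setT [seq sgn f x | f <- gs].
  apply/seteqP; split => y /= zy.
    by split => //=; apply/mapsgnE => f fgs; rewrite /sgn zx // zy.
  case: zy => _ /= /mapsgnE e f fgs; apply/sgn_eq0; rewrite e //.
  exact/sgn_eq0/zx.
have [e|//] := cell_relopen gs [seq sgn f x | f <- gs] (@relopenT R n).
by have : set0 x by rewrite -e.
Qed.

Lemma zeros_translate gs U x v : relopen U (zeros gs) -> zeros gs x ->
  (v <= U)%MS -> zeros gs (x + v).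
Proof.
move=> [_ _ _ op] zx vU f fgs; have [e e0 he] := op _ _ zx vU.
have := he e (ltW e0) (lexx e) f fgs.
rewrite evD zx // add0r => /eqP; rewrite mulf_eq0 gt_eqF //= => /eqP dv.
by rewrite -[v]scale1r evD dv zx // mulr0 addr0.
Qed.

Lemma flats_zeros H fs X : represents H fs ->
  X \in flats H <-> exists2 gs, {subset gs <= fs} & X = zeros gs.
Proof.
move=> [f0 fH]; split.
  move=> /flatsP[G /fsubsetP GH ->].
  exists [seq f <- fs | hyp f.1 f.2 \in G].
    by move=> f; rewrite mem_filter => /andP[].
  apply/seteqP; split => x /= hx.
    move=> f; rewrite mem_filter => /andP[fG _].
    by have := hx _ fG; rewrite /hyp /= /ev => ->; rewrite subrr.
  move=> h hG; have [f ffs hE] := (fH h).1 (GH _ hG); rewrite hE /hyp /=.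
  have := hx f; rewrite mem_filter ffs -hE [h \in G]hG => /(_ isT) /eqP.
  by rewrite subr_eq0 => /eqP.
move=> [gs gfs ->]; apply/flatsP.
exists [fset h in H | `[< exists2 f, f \in gs & h = hyp f.1 f.2 >]]%fset.
  by apply/fsubsetP => h; rewrite !inE => /andP[].
apply/seteqP; split => x /= hx.
  move=> h; rewrite /= !inE => /andP[_ /asboolP[f fgs ->]]; rewrite /hyp /=.
  by have /eqP := hx f fgs; rewrite subr_eq0 => /eqP.
move=> f fgs; apply/eqP; rewrite subr_eq0; apply/eqP.
apply: (hx (hyp f.1 f.2)); rewrite /= !inE; apply/andP; split.
  by apply/fH; exists f => //; exact: gfs.
by apply/asboolP; exists f.
Qed.

Lemma flat_face_sub H fs X (F : face H) x : represents H fs -> X \in flats H ->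
  X x -> val F x -> val F `<=` X.
Proof.
move=> rH /(flats_zeros _ rH)[gs gfs ->] zx Fx y Fy f fgs; apply/sgn_eq0.
rewrite (face_sgn rH Fy Fx) ?gfs //; exact/sgn_eq0/zx.
Qed.

Lemma sub_aff_hull C : C `<=` aff_hull C.
Proof.
move=> x Cx; exists 1%N, (fun=> x), (fun=> 1); split => //.
  by rewrite big_ord1.
by rewrite big_ord1 scale1r.
Qed.

Lemma aff_hull_zeros C gs : C `<=` zeros gs -> aff_hull C `<=` zeros gs.
Proof.
move=> Cg y [k [p [c [Cp c1 ->]]]] f fgs.
rewrite /ev dot_sum -[f.2]mul1r -c1 mulr_suml -sumrB big1 // => i _.
by have := Cg _ (Cp i) f fgs; rewrite /ev -mulrBr => ->; rewrite mulr0.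
Qed.

Lemma hull_sub H fs X (F : face H) : represents H fs -> X \in flats H ->
  (aff_hull (val F) `<=` X) <-> (val F `<=` X).
Proof.
move=> rH /(flats_zeros _ rH)[gs gfs ->]; split; last exact: aff_hull_zeros.
exact: subset_trans (@sub_aff_hull _).
Qed.

(** Affine combinations of points of [F] differ from a point of [F] by vectors in its direction
    space. This makes [(-1)^dim F] constant on the faces with a given hull. *)
Lemma adim_hull H fs (F : face H) : represents H fs ->
  adim (aff_hull (val F)) = adim (val F).
Proof.
move=> rH; have [U gU] := face_relopen F rH; have [x Fx] := face_rep F.
have [gs _ hE] := (flats_zeros _ rH).1 (aff_hull_face F).
have [|U' gU'] := @zeros_relopen gs x; first by rewrite -hE; exact: sub_aff_hull.
rewrite (adimE gU) hE (adimE gU').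
apply/eqP; rewrite eqn_leq; apply/andP; split; apply: mxrankS; last first.
  by apply: (relopen_sub gU gU'); rewrite -hE; exact: sub_aff_hull.
have aU y : aff_hull (val F) y -> (y - x <= U)%MS.
  move=> [k [p [c [Fp c1 ->]]]].
  rewrite -[x in _ - x]scale1r -c1 scaler_suml -sumrB; apply: summx_sub => i _.
  by rewrite -scalerBr scalemx_sub //; have [_ _ dif _] := gU; exact: dif.
apply/rV_subP => v vU'; have := aU (x + v); rewrite addrAC subrr add0r; apply.
by rewrite hE; apply: (zeros_translate gU') => //; rewrite -hE; exact: sub_aff_hull.
Qed.

(** The order on sign vectors: those of adherent points arise from that of [F] by replacing some
    entries by 0. *)
Lemma adherent_face H fs (F : face H) p y : represents H fs -> val F y ->
  adherent p (val F) <-> forall f, f \in fs -> sgn f p = 0 \/ sgn f p = sgn f y.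
Proof.
move=> rH Fy; split=> [[z Fz hz] f ffs|hp].
  have [p0|p0] := eqVneq (ev f p) 0; [by left; apply/sgn_eq0|right].
  have [e e0 he] := sgr_stable (dot f.1 (z - p)) p0.
  have t0 : 0 < Num.min e 1 by rewrite lt_min e0 ltr01.
  have Fw : val F (p + Num.min e 1 *: (z - p)) by apply: hz; rewrite ?ge_min ?lexx ?orbT.
  by rewrite -(face_sgn rH Fw Fy ffs) /sgn evD he // ?ge_min ?lexx // ltW.
exists y => // t t0 t1; apply: (face_sgn_mem rH Fy) => f ffs.
rewrite {2}/sgn ev_seg; have [p0|py] := hp f ffs;
  last by rewrite (sgr_conv (esym py) (ltW t0) t1) -py.
by move/sgn_eq0: p0 => ->; rewrite add0r subr0 sgrM gtr0_sg // mul1r.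
Qed.

(** Bridge from the topological face order to segments. Weak inequalities pass to the closure and
    give the sign criterion of [adherent_face]; conversely, points of the segment tend to [p]. *)
Lemma closure_adherent H fs (F : face H) p : represents H fs ->
  closure (val F) p <-> adherent p (val F).
Proof.
move=> rH; have [y Fy] := face_rep F; split.
  move=> cl; apply/(adherent_face _ rH Fy) => f ffs.
  have [f0 fH] := rH; have hH : hyp f.1 f.2 \in H by apply/fH; exists f.
  rewrite (faceE Fy) in cl; have [h1 h2] := closure_face_sign (f0 _ ffs) hH cl.
  move: h1 h2; rewrite -!/(ev _ _); have [[a ea]|[a ea]|[a ea]] := sgn_cases f p;
  have [[b eb]|[b eb]|[b eb]] := sgn_cases f y; rewrite ea eb => h1 h2;
    try (by left); try (by right); exfalso.
  - by have := h1 _; lra.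
  - by have := h1 _; lra.
  - by have := h2 _; lra.
  - by have := h2 _; lra.
move=> [z Fz hz] B Bp.
have cont : p + t *: (z - p) @[t --> (0 : R)] --> p.
  have -> : nbhs p = nbhs (p + (0 : R) *: (z - p)) by rewrite scale0r addr0.
  apply: cvgD; first exact: cvg_cst.
  by apply: cvgZl; exact: cvg_id.
have /nbhs_ballP[e /= e0 he] := cont _ Bp.
exists (p + Num.min (e / 2) 1 *: (z - p)); split.
  by apply: hz; rewrite ?ge_min ?lexx ?orbT // lt_min ltr01 divr_gt0.
apply: he; rewrite /ball /= sub0r normrN ger0_norm; last first.
  by rewrite le_min ler01 divr_ge0 // ltW.
by rewrite gt_min; apply/orP; left; lra.
Qed.

Lemma face_leP H fs (G F : face H) p : represents H fs -> val G p ->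
  (G <= F)%O <-> adherent p (val F).
Proof.
move=> rH Gp; have [y Fy] := face_rep F; split.
  by move=> /asboolP GF; apply/(closure_adherent _ _ rH)/GF.
move=> /(adherent_face _ rH Fy) hp; apply/asboolP => q Gq.
apply/(closure_adherent _ _ rH)/(adherent_face _ rH Fy) => f ffs.
by rewrite (face_sgn rH Gq Gp ffs); exact: hp.
Qed.

(** * Unbounded faces and rays *)

Lemma ray_unbounded C : has_ray C -> ~ bounded_set C.
Proof.
move=> [x [v [v0 hv]]] [M [_ hM]].
have vn : 0 < `|v| by rewrite normr_gt0.
pose N := `|M| + 1; have MN : M < N by rewrite /N; have := ler_norm M; lra.
have N0 : 0 <= N by rewrite /N addr_ge0.
pose t := (`|x| + N + 1) / `|v|.
have t0 : 0 <= t by rewrite /t divr_ge0 // !addr_ge0.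
have := hM N MN _ (hv t t0); rewrite /= => h.
have : `|t *: v| <= `|x + t *: v| + `|x|.
  rewrite -{1}[t *: v](addKr x) addrC; apply: le_trans (ler_normB _ _) _.
  by rewrite lexx.
rewrite normrZ (ger0_norm t0) /t divfK ?gt_eqF //; lra.
Qed.

(** Points [u k] of [F] at distance more than [k] from [x] give unit directions [v k], which cluster
    at some [w] on the compact unit sphere. The sign conditions defining [F] pass to the limit and
    make [w] the direction of a ray from [x]. *)
Lemma unbounded_ray H fs (F : face H) : represents H fs ->
  ~ bounded_set (val F) -> has_ray (val F).
Proof.
move=> rH nb; have [x Fx] := face_rep F.
have far (k : nat) : exists y, val F y /\ k%:R < `|y - x|.
  apply: contrapT => no; apply: nb; exists (`|x| + k%:R); split; first exact: num_real.
  move=> M /ltW hM y Fy /=; apply: le_trans hM; rewrite leNgt; apply/negP => yk.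
  apply: no; exists y; split => //; have := lerB_normD y (- x).
  have := ler_normD (y - x) x; rewrite subrK; lra.
have [u hu] := choice far.
pose v k := `|u k - x|^-1 *: (u k - x).
have un k : 0 < `|u k - x| by apply: le_lt_trans (hu k).2.
pose S := [set w : V | `|w| = 1].
have vS k : S (v k) by rewrite /S /= normrZ ger0_norm ?invr_ge0 // mulVf ?gt_eqF.
have cS : compact S.
  apply: bounded_closed_compact.
    exists 1; split; first exact: num_real.
    by move=> M /ltW M1 w /= ->.
  have -> : S = (fun w : V => `|w|) @^-1` [set r : R | r = 1] by [].
  by apply: preimage_closed; [move=> w _; exact: norm_continuous|exact: closed_eq].
have [|w [Sw cw]] := cS (v @ \oo) _; first by exists 0%N => // k _; exact: vS.
rewrite clusterE in cw.
(* If [dot a w = -2e] with [e] positive, then [dot a (v k) >= -e] as soon as [k > c / e]. This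
   closed condition passes to the cluster point [w], a contradiction. *)
have lim (a : V) c : 0 <= c -> (forall k, - c <= k%:R * dot a (v k)) -> 0 <= dot a w.
  move=> c0 hk; rewrite leNgt; apply/negP => wn.
  pose e := - dot a w / 2; have e0 : 0 < e by rewrite /e; lra.
  have cl : closed (dot a @^-1` [set r | - e <= r]).
    by apply: preimage_closed; [move=> z _; exact: dot_continuous|exact: closed_ge].
  suff : (dot a @^-1` [set r | - e <= r]) w by rewrite /= /e; lra.
  apply: cl; apply: cw.
  exists (Num.truncn (c / e)).+1 => // k /= hkc.
  have ck : c < k%:R * e.
    by rewrite -ltr_pdivrMr //; apply: lt_le_trans (truncnS_gt _) _; rewrite ler_nat.
  have k0 : 0 < k%:R :> R by rewrite ltr0n; exact: leq_trans hkc.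
  rewrite -(ler_pM2l k0); have := hk k; lra.
(* Since [q = k / |u k - x|] is at most 1, the scaled slope lies between 0 and
   [ev f (u k) - ev f x]. As [u k] and [x] have equal signs, this supplies the uniform bound that
   [lim] needs. *)
have vE f k : exists2 q, 0 <= q <= 1 &
    k%:R * dot f.1 (v k) = q * (ev f (u k) - ev f x).
  exists (k%:R / `|u k - x|); last by rewrite dotZ evB mulrA.
  by rewrite divr_ge0 //= ler_pdivrMr // mul1r ltW // (hu k).2.
have dotNl a z : dot (- a) z = - dot a z by rewrite dotC dotN dotC.
have sgw f : f \in fs -> forall t, 0 <= t ->
    sgn f (x + t *: w) = sgn f x.
  move=> ffs.
  have su k : sgn f (u k) = sgn f x by apply: (face_sgn rH (hu k).1 Fx).
  move=> t t0; rewrite /sgn evD.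
  have [[a ea]|[a ea]|[a ea]] := sgn_cases f x.
  - have : 0 <= dot (- f.1) w.
      apply: (lim _ (- ev f x)); first lra.
      move=> k; rewrite dotNl mulrN; have [q /andP[q0 q1] ->] := vE f k.
      move: (su k); rewrite ea => /eqP; rewrite /sgn sgr_cp0 => b; nra.
    rewrite dotNl => dw; rewrite -/(sgn f x) ea ltr0_sg //; nra.
  - have z k : k%:R * dot f.1 (v k) = 0.
      have [q _ ->] := vE f k; move: (su k); rewrite ea a => /sgn_eq0 ->.
      by rewrite subrr mulr0.
    have h1 : 0 <= dot f.1 w by apply: (lim _ 0) => // k; rewrite z oppr0.
    have : 0 <= dot (- f.1) w.
      by apply: (lim _ 0) => // k; rewrite dotNl mulrN z oppr0.
    rewrite dotNl => h2; have -> : dot f.1 w = 0 by lra.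
    by rewrite mulr0 addr0.
  - have : 0 <= dot f.1 w.
      apply: (lim _ (ev f x)); first lra.
      move=> k; have [q /andP[q0 q1] ->] := vE f k.
      move: (su k); rewrite ea => /eqP; rewrite /sgn sgr_cp0 => b; nra.
    move=> dw; rewrite -/(sgn f x) ea gtr0_sg //; nra.
exists x, w; split; first by rewrite -normr_gt0; move: Sw => /= ->.
by move=> t t0; apply: (face_sgn_mem rH Fx) => f /sgw ->.
Qed.

End Arrangement.

(** * Euler relations *)

Lemma ltn_count (T : eqType) (a b : pred T) s f : f \in s ->
  (forall g, g \in s -> a g -> b g) -> ~~ a f -> b f -> (count a s < count b s)%N.
Proof.
move=> fs ab naf bf.
have le r : {subset r <= s} -> (count a r <= count b r)%N.
  elim: r => [//|g r IH] rs /=; apply: leq_add; last by apply: IH => h hr; apply: rs;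
    rewrite inE hr orbT.
  by move: (ab g (rs _ (mem_head _ _))); case: (a g) => // ->.
have [s1 [s2 e]] : exists s1 s2, s = s1 ++ f :: s2 by case/splitPr: fs => s1 s2;
  exists s1, s2.
rewrite e !count_cat /= (negbTE naf) bf add0n add1n addnS ltnS; apply: leq_add;
  apply: le => g gs;
  by rewrite e mem_cat ?inE gs ?orbT.
Qed.

Section Counting.
Context {R : realType} {n : nat}.
Local Notation V := 'rV[R]_n.
Local Open Scope classical_set_scope.
Implicit Types (f : V * R) (C X : set V) (U : 'M[R]_n) (P : set V -> Prop)
  (H : {fset set V}) (fs gs : seq (V * R)).

Lemma cell_cat fs1 fs2 C s1 s2 : size fs1 = size s1 ->
  cell (fs1 ++ fs2) C (s1 ++ s2) = cell fs2 (cell fs1 C s1) s2.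
Proof.
elim: fs1 C s1 => [|f fs1 IH] C [|c s1] //= => [_|[e]]; first by rewrite cell_nil.
by rewrite !cell_cons IH.
Qed.

Lemma sum_signs_cat m1 m2 (F : seq R -> int) :
  \sum_(s <- signs (m1 + m2)) F s =
  \sum_(s1 <- signs m1) \sum_(s2 <- signs m2) F (s1 ++ s2).
Proof.
elim: m1 F => [|m1 IH] F; first by rewrite big_seq1.
by rewrite addSn !signsS !big_allpairs_dep; apply: eq_bigr => c _; rewrite IH.
Qed.

Lemma size_signs m (s : seq R) : s \in signs m -> size s = m.
Proof.
elim: m s => [|m IH] s; first by rewrite inE => /eqP ->.
by rewrite signsS => /allpairsP[[c t] /= [_ /IH <- ->]].
Qed.

(** A flat is a union of faces, so its nonempty cells are exactly the faces inside it; empty cells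
    have weight 0. *)
Lemma sum_cells H gs X P : represents H gs -> X \in flats H -> ~ P set0 ->
  \sum_(s <- signs (size gs)) weight P (cell gs X s) =
  \sum_(F : face H | `[< val F `<=` X >]) weight P (val F).
Proof.
move=> rH XH P0.
have [rp rpP] := choice (@face_rep R n H).
pose sg F := [seq sgn f (rp F) | f <- gs].
have cellE F : val F `<=` X -> cell gs X (sg F) = val F.
  move=> FX; rewrite (faceE (rpP F)) -(cell_face _ rH).
  apply/seteqP; split => y [_ ys]; split => //; apply: FX.
  by rewrite (faceE (rpP F)) -(cell_face _ rH).
rewrite -[RHS]big_filter.
set r := [seq F <- _ | _].
have rE F : F \in r = `[< val F `<=` X >].
  by rewrite mem_filter mem_index_enum andbT.
transitivity (\sum_(s <- [seq sg F | F <- r]) weight P (cell gs X s)); last first.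
  by rewrite big_map; apply: eq_big_seq => F; rewrite rE => /asboolP /cellE ->.
rewrite (bigID (fun s => `[< cell gs X s !=set0 >])) /= addrC big1 ?add0r; last first.
  move=> s /asboolP ns; rewrite (_ : cell gs X s = set0) ?weight0 //.
  by apply/eqP; apply: contra_notT ns => /set0P.
rewrite -big_filter; apply: perm_big; apply: uniq_perm.
- by rewrite filter_uniq // signs_uniq.
- rewrite map_inj_in_uniq ?filter_uniq ?index_enum_uniq // => F G.
  rewrite !rE => /asboolP FX /asboolP GX e.
  by apply/val_inj; rewrite -(cellE _ FX) -(cellE _ GX) e.
move=> s; rewrite mem_filter; apply/andP/mapP.
  move=> [/asboolP[x [Xx /= xs]] _]; exists (face_of H x).
    by rewrite rE; apply/asboolP; exact: (flat_face_sub rH XH Xx).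
  rewrite -xs; apply/mapsgnE => f fgs.
  exact: (@face_sgn _ _ H gs (face_of H x)).
move=> [F]; rewrite rE => /asboolP FX ->; split; last exact: mem_signs.
by apply/asboolP; exists (rp F); rewrite cellE.
Qed.

Definition separating fs : Prop :=
  forall v : V, (forall f, f \in fs -> dot f.1 v = 0) -> v = 0.

(** A vector orthogonal to normals that span the space is orthogonal to itself. *)
Lemma essential_separating H fs : represents H fs -> essential H -> separating fs.
Proof.
move=> [f0 fH] [s [sH sV]] v vf; apply/eqP; apply: contraT => /dot_gt0.
have sv a : a \in s -> dot a v = 0.
  move=> /sH [h hH [a0 [b hE]]]; have [f ffs hE'] := (fH h).1 hH.
  have [c cE] := hyp_eqP (f0 _ ffs) (etrans (esym hE') hE).
  have := cE v; have := cE 0; by rewrite !dot0 vf // => <- /addIr.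
have : v \in <<in_tuple s>>%VS by rewrite sV memvf.
move=> /coord_span {1}->; rewrite dotC dot_sum big1 ?ltxx // => i _.
by rewrite dotC sv ?mulr0 // mem_nth.
Qed.

(* While possible, slide along a line on which the functionals vanishing at
   [x] are constant until one more of them vanishes. *)
Lemma exists_vertex fs gs x : separating fs -> {subset gs <= fs} -> zeros gs x ->
  exists2 x0, zeros gs x0 & separating [seq f <- fs | ev f x0 == 0].
Proof.
move=> sep gfs; move En : (count (fun f => ev f x != 0) fs) => N.
elim/ltn_ind: N x En => N IH x EN zx.
have [|/existsNP[v /not_implyP[hv v0]]] := pselect (separating [seq f <- fs | ev f x == 0]).
  by exists x.
have {}hv f : f \in fs -> ev f x = 0 -> dot f.1 v = 0.
  by move=> ffs fx; apply: hv; rewrite mem_filter fx eqxx.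
have [f ffs fv] : exists2 f, f \in fs & dot f.1 v != 0.
  apply: contrapT => no; apply: v0; apply: sep => f ffs; apply/eqP.
  by apply: contraT => fv; case: no; exists f.
have fx : ev f x != 0 by apply: contra fv => /eqP /(hv _ ffs) ->.
pose y := x + (- ev f x / dot f.1 v) *: v.
apply: (IH (count (fun f => ev f y != 0) fs) _ y) => //; rewrite -?EN.
  apply: (ltn_count ffs) => // [g gfs'|]; last by rewrite negbK evD divfK // subrr.
  by apply: contra => /eqP gx; rewrite evD gx (hv g) // mulr0 addr0.
by move=> g ggs; rewrite evD zx // (hv g) ?mulr0 ?addr0 //; [exact: gfs|exact: zx].
Qed.

Lemma sum_adherent H fs X p : represents H fs -> X \in flats H -> X p ->
  \sum_(F : face H | `[< val F `<=` X >]) weight (adherent p) (val F) = (-1) ^+ adim X.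
Proof.
move=> rH XH Xp; rewrite -(sum_cells rH XH); last by move=> [].
have [gs _ XE] := (flats_zeros _ rH).1 XH.
have [U gU] : exists U, relopen U X by rewrite XE in Xp *; exact: zeros_relopen Xp.
rewrite (@euler_sum _ _ _ (fun=> True) fs _ _ _ U X) //.
- by rewrite /weight asboolT //; exists p => // t t0 t1; rewrite subrr scaler0 addr0.
- by move=> [].
- by move=> U' C gC _; exact: splits_adherent gC.
Qed.

Lemma sum_ray H fs X : represents H fs -> separating fs -> X \in flats H -> X !=set0 ->
  \sum_(F : face H | `[< val F `<=` X >]) weight has_ray (val F) = (-1) ^+ adim X - 1.
Proof.
move=> rH sep XH [x Xx]; have [gs gfs XE] := (flats_zeros _ rH).1 XH.
have [|x0 zx0] := exists_vertex sep gfs (x := x); first by rewrite -XE.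
set fs1 := [seq f <- fs | _] => sep1.
have Xx0 : X x0 by rewrite XE.
have [U gU] : exists U, relopen U X by rewrite XE in Xx *; exact: zeros_relopen Xx.
have fs1x0 f : f \in fs1 -> ev f x0 = 0 by rewrite mem_filter => /andP[/eqP].
(* With [fs1] in front, [cell_cat] performs the cuts through [x0] before all others. *)
have rH' : represents H (fs1 ++ fs).
  have [f0 fH] := rH; have sub f : f \in fs1 ++ fs -> f \in fs.
    by rewrite mem_cat mem_filter => /orP[/andP[]|].
  split=> [f /sub /f0 //|h]; split=> [/fH[f ffs ->]|[f /sub ffs ->]].
    by exists f => //; rewrite mem_cat ffs orbT.
  by apply/fH; exists f.
have nray : ~ has_ray (set0 : set V) by move=> [y [v [_ /(_ 0 (lexx 0))]]].
rewrite -(sum_cells rH' XH nray) size_cat sum_signs_cat.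
(* A functional of [fs1] that is not constant on the line would take the values 0 and 1 there, but
   its sign is constant on a cell. *)
have line s : has_no_line (cell fs1 X s).
  move=> y v v0 hv; move/eqP: v0; apply; apply: sep1 => f ffs.
  apply/eqP; apply: contraT => fv.
  have same t : sgn f (y + t *: v) = sgn f y.
    have [_ /= e1] := hv t; have [_ /= e2] := hv 0; rewrite scale0r addr0 in e2.
    by move: f ffs {fv}; apply/mapsgnE; rewrite e1 e2.
  have := same (- ev f y / dot f.1 v); rewrite {1}/sgn evD divfK // subrr sgr0.
  have := same ((1 - ev f y) / dot f.1 v); rewrite {1}/sgn evD divfK //.
  by rewrite addrC subrK sgr1 => <- /eqP; rewrite eq_sym oner_eq0.
transitivity (\sum_(s <- signs (size fs1))
   (weight (fun C => C !=set0) (cell fs1 X s) - `[< cell fs1 X s x0 >]%:R)).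
  apply: eq_big_seq => s sm.
  transitivity (weight has_ray (cell fs1 X s)).
    have := size_signs sm => ss.
    under eq_bigr do rewrite cell_cat //.
    have [->|[U' gU']] := cell_relopen fs1 s gU.
      by rewrite weight0 // big1 // => t _; rewrite cell_set0 weight0.
    apply: (@euler_sum _ _ _ (fun C => has_no_line C) fs _ _ _ U') => //.
    - move=> C C' nl CC' y v v0 hv; apply: (nl y v v0) => t; exact: CC'.
    - by move=> U'' C gC nl; exact: splits_ray gC nl.
  have [->|[U' gU']] := cell_relopen fs1 s gU.
    rewrite !weight0 // => [|[]//]; rewrite asboolF ?subrr //.
  have ne : cell fs1 X s !=set0 by have [] := gU'.
  rewrite /weight (asboolT ne).
  (* On the cell of [x0] all of [fs1] vanishes, and [separating] leaves a single point. *)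
  have sx0 y : cell fs1 X s x0 -> cell fs1 X s y -> y = x0.
    move=> [_ /= e0] [_ /= ey]; apply/eqP; rewrite -subr_eq0; apply/eqP/sep1 => f ffs.
    rewrite evB fs1x0 // subr0; apply/sgn_eq0.
    have /mapsgnE -> // : [seq sgn f y | f <- fs1] = [seq sgn f x0 | f <- fs1] by rewrite
      e0.
    exact/sgn_eq0/fs1x0.
  have [cx0|ncx0] := pselect (cell fs1 X s x0).
    rewrite (asboolT cx0) asboolF.
      rewrite (adimE gU') (_ : \rank U' = 0%N) ?expr0 ?subrr //.
      apply/eqP; rewrite mxrank_eq0 -submx0; apply/rV_subP => v vU.
      have [_ _ _ op] := gU'; have [e e0 he] := op _ _ cx0 vU.
      have /eqP := sx0 _ cx0 (he e (ltW e0) (lexx e)).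
      rewrite -subr_eq0 addrAC subrr add0r scaler_eq0 gt_eqF //= => /eqP ->.
      exact: sub0mx.
    move=> [y [v [v0 hv]]]; have := sx0 _ cx0 (hv 0 (lexx 0)).
    have := sx0 _ cx0 (hv 1 ler01); rewrite scale0r scale1r addr0 => e ey.
    by move: e; rewrite ey -[RHS]addr0 => /addrI ve; rewrite ve eqxx in v0.
  (* Every other cell is a cone with apex [x0]: moving from [y] along [y - x0] multiplies each
     functional of [fs1] by [1 + t > 0]. *)
  rewrite (asboolF ncx0) subr0 asboolT //; have [y cy] := ne.
  exists y, (y - x0); split.
    by rewrite subr_eq0; apply/eqP => e; rewrite -e in ncx0.
  move=> t t0; have [Xy /= ys] := cy; split.
    rewrite XE in Xy * => f fgs; rewrite evD evB Xy // zx0 // subr0 mulr0 addr0 //.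
  rewrite /= -ys; apply/mapsgnE => f ffs.
  rewrite /sgn evD evB fs1x0 // subr0 -{1}[ev f y]mul1r -mulrDl sgrM gtr0_sg ?mul1r //; lra.
rewrite sumrB (@euler_sum _ _ _ (fun=> True) fs1 _ _ _ U X) //; first last.
- by move=> U' C gC _; exact: splits_nonempty gC.
- by move=> [].
rewrite {1}/weight asboolT; last by exists x.
congr (_ - _).
rewrite (bigD1_seq [seq sgn f x0 | f <- fs1]) ?signs_uniq ?mem_signs //=.
rewrite asboolT // big1 ?addr0 // => s; rewrite eq_sym => /eqP ns.
by rewrite asboolF // => -[_ /= e].
Qed.

End Counting.

(** * Numbers of faces with a given affine hull *)

Section Heights.
Context {R : realType} {n : nat}.
Local Notation V := 'rV[R]_n.
Local Open Scope classical_set_scope.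
Implicit Types (f : V * R) (C X Y : set V) (U : 'M[R]_n) (P : set V -> Prop)
  (H : {fset set V}) (fs gs : seq (V * R)).

(** The shift by one puts the empty flat a level below the points, so that ranks in the lattice are
    differences of heights up to its maximum. *)
Definition height X : nat := if `[< X !=set0 >] then (adim X).+1 else 0%N.

Lemma height_set0 : height set0 = 0%N.
Proof. by rewrite /height asboolF // => -[]. Qed.

Lemma height_nonempty X : X !=set0 -> height X = (adim X).+1.
Proof. by move=> X0; rewrite /height asboolT. Qed.

Lemma height_lt H fs X Y : represents H fs -> X \in flats H -> Y \in flats H ->
  Y `<=` X -> Y <> X -> (height Y < height X)%N.
Proof.
move=> rH /(flats_zeros _ rH)[gX _ ->] /(flats_zeros _ rH)[gY _ ->] YX ne.
have [Y0|] := eqVneq (zeros gY) set0; last first.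
  move=> /set0P [y zy]; have zx := YX _ zy.
  rewrite !height_nonempty; [|by exists y|by exists y].
  have [UX gUX] := zeros_relopen zx; have [UY gUY] := zeros_relopen zy.
  rewrite (adimE gUX) (adimE gUY) ltnS ltn_neqAle mxrankS ?(relopen_sub gUY gUX YX)
    ?andbT //.
  apply/negP => e; apply: ne; apply/seteqP; split => // w zw.
  have le : (UX <= UY)%MS by rewrite -(geq_leqif (mxrank_leqif_sup (relopen_sub gUY gUX
    YX))) (eqP e).
  rewrite -(subrK y w) addrC; apply: (zeros_translate gUY zy).
  by apply: submx_trans le; have [_ _ dif _] := gUX; exact: dif.
rewrite Y0 height_set0 in ne *; rewrite height_nonempty //; apply/set0P/eqP => X0.
by apply: ne; rewrite X0.
Qed.

(** Cutting [X] by an equation that is not constant on it lowers the dimension by one. If [Y] is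
    nonempty, one of its own equations does this and keeps [Y] inside; if [Y] is empty, any equation
    of the arrangement that varies on [X] will do. *)
Lemma height_cover H fs X Y : represents H fs -> separating fs ->
  X \in flats H -> Y \in flats H -> Y `<=` X -> Y <> X ->
  exists W, [/\ W \in flats H, Y `<=` W, W `<=` X & height X = (height W).+1].
Proof.
move=> rH sep XH YH YX ne.
have [gX gXfs XE] := (flats_zeros _ rH).1 XH.
have [gY gYfs YE] := (flats_zeros _ rH).1 YH.
have [x Xx] : X !=set0.
  by apply/set0P/eqP => X0; apply: ne; move: YX; rewrite X0 subset0 => ->.
have [U gU] : exists U, relopen U X by rewrite XE in Xx *; exact: zeros_relopen Xx.
have cut f v : f \in fs -> (v <= U)%MS -> dot f.1 v != 0 -> Y `<=` [set y | ev f y = 0] ->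
    exists W, [/\ W \in flats H, Y `<=` W, W `<=` X & height X = (height W).+1].
  move=> ffs vU fv Yf.
  have WE : piece f 0 X = zeros (f :: gX).
    rewrite XE; apply/seteqP; split => y /=.
      move=> [zy /= /sgn_eq0 fy] g; rewrite inE => /orP[/eqP->//|]; exact: zy.
    move=> zy; split; last by apply/sgn_eq0/zy; rewrite mem_head.
    by move=> g gg; apply: zy; rewrite inE gg orbT.
  exists (piece f 0 X); split.
  - apply/(flats_zeros _ rH); exists (f :: gX) => // g; rewrite inE => /orP[/eqP->//|].
    exact: gXfs.
  - by move=> y Yy; split; [exact: YX|apply/sgn_eq0/Yf].
  - by move=> y [].
  have wne : piece f 0 X !=set0.
    exists (x + (- ev f x / dot f.1 v) *: v); split.
      by rewrite XE in Xx gU *; apply: (zeros_translate gU) => //; exact: scalemx_sub.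
    by apply/sgn_eq0; rewrite evD divfK // subrr.
  rewrite !height_nonempty //; last by exists x.
  by rewrite (adimE gU) (adimE (relopen_piece0 gU wne)) (rank_cap_ker vU fv).
have [Y0|] := eqVneq Y set0; last first.
  move=> /set0P[y Yy].
  have [f fg [z Xz fz]] : exists2 f, f \in gY & exists2 z, X z & ev f z != 0.
    apply: contrapT => no; apply: ne; apply/seteqP; split => // z Xz; rewrite YE => f fg.
    by apply/eqP; apply: contraT => fz; case: no; exists f => //; exists z.
  have Yf : Y `<=` [set y | ev f y = 0] by rewrite YE => w /(_ f fg).
  apply: (cut f (z - y)) => //; first exact: gYfs.
    by have [_ _ dif _] := gU; apply: dif => //; exact: YX.
  by rewrite evB (Yf _ Yy) subr0.
have [[f [v [ffs vU fv]]]|no] :=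
  pselect (exists f v, [/\ f \in fs, (v <= U)%MS & dot f.1 v != 0]).
  by apply: (cut f v) => //; rewrite Y0.
(* No equation varies on [X], so [separating] makes [X] a point: height 1, just above the empty
   flat. *)
exists Y; split => //; rewrite Y0 height_set0 height_nonempty; last by exists x.
rewrite (adimE gU) (_ : \rank U = 0%N) //; apply/eqP; rewrite mxrank_eq0 -submx0.
apply/rV_subP => v vU; rewrite (sep v) ?sub0mx // => f ffs; apply/eqP.
by apply: contraT => fv; case: no; exists f, v.
Qed.

Lemma lattice_leP H (X Y : lattice H) : (X <= Y)%O <-> val Y `<=` val X.
Proof. by split => [/asboolP|h]; last apply/asboolP. Qed.

Lemma rank_lattice H fs (X Y : lattice H) : represents H fs -> separating fs ->
  (X <= Y)%O ->
  rank (Some X : adjoin_min (lattice H)) (Some Y) = (height (val X) - height (val Y))%N.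
Proof.
move=> rH sep XY.
(* [None] is not above [Some X], so its value is arbitrary. *)
pose del (z : adjoin_min (lattice H)) := if z is Some W then height (val W) else 0%N.
have lt_sub (W W' : lattice H) : ((Some W : adjoin_min (lattice H)) < Some W')%O ->
    val W' `<=` val W /\ val W' <> val W.
  rewrite lt_neqAle => /andP[ne le]; split; first exact/lattice_leP.
  by move=> e; case/eqP: ne; congr Some; apply/val_inj.
apply: (rank_eq_diff (del := del)) => //.
  move=> [z|//] [u|//] _ /lt_sub[zu ne] _.
  exact: (height_lt rH (valP z) (valP u)).
move=> [z|//] _ /lt_sub[zy ne].
have [W [WH YW Wz hW]] := height_cover rH sep (valP z) (valP Y) zy ne.
exists (Some [` WH]%fset); split => //; last by apply/lattice_leP.
rewrite lt_neqAle; apply/andP; split; last by apply/lattice_leP.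
by apply/eqP => -[e]; move: hW; rewrite e /=; lia.
Qed.

End Heights.

Lemma signr_sub (a b : nat) : (b <= a)%N -> (-1) ^+ (a - b) = (-1) ^+ a * (-1) ^+ b :> int.
Proof. by move=> ba; rewrite -{2}(subnK ba) exprD -mulrA -expr2 sqrr_sign mulr1. Qed.

(** * Faces with a given hull by Moebius inversion *)

Section FaceCount.
Context {R : realType} {n : nat}.
Local Notation V := 'rV[R]_n.
Local Open Scope classical_set_scope.
Implicit Types (H : {fset set V}) (fs : seq (V * R)).

Lemma hull_leP H fs (F : face H) (W : lattice H) : represents H fs ->
  (W <= face_hull F)%O = `[< val F `<=` val W >].
Proof.
move=> rH; apply: asbool_equiv_eq; exact: (hull_sub F rH (valP W)).
Qed.

(** A face lies in [W] exactly when its hull does. Grouping by hulls turns the signed count of faces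
    in [W] into a sum over the flats of [[W, Y]], with a constant sign on each group; inversion
    isolates the group of [X]. *)
Lemma mobius_count H fs (p : pred (face H)) (X Y : lattice H)
    (h : adjoin_min (lattice H) -> int) : represents H fs ->
  (X <= Y)%O -> (forall F, p F -> (face_hull F <= Y)%O) ->
  (forall W : lattice H, (X <= W)%O -> (W <= Y)%O ->
    \sum_(F : face H | `[< val F `<=` val W >] && p F) (-1) ^+ adim (val F) = h (Some W)) ->
  \sum_(z : adjoin_min (lattice H) | ((Some X : adjoin_min (lattice H)) <= z)%O &&
    (z <= Some Y)%O)
     mobius (Some X : adjoin_min (lattice H)) z * h z =
  (-1) ^+ adim (val X) * (#|[pred F | (face_hull F == X) && p F]|)%:Z.
Proof.
move=> rH XY pY hW.
pose g (z : adjoin_min (lattice H)) : int := if z is Some W then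
  (-1) ^+ adim (val W) * (#|[pred F | (face_hull F == W) && p F]|)%:Z else 0.
rewrite (@mobius_inversion _ _ _ _ g) // => -[W|//] XW WY; rewrite -hW //.
rewrite (partition_big (fun F => Some (face_hull F) : adjoin_min (lattice H))
  (fun u => ((Some W : adjoin_min (lattice H)) <= u)%O && (u <= Some Y)%O)); last first.
  move=> F /andP[FW pF]; apply/andP; split; last exact: pY.
  by have := hull_leP F W rH; rewrite FW.
apply: eq_bigr => -[W'|//] /andP[WW' W'Y]; rewrite [LHS]/=.
rewrite -natz -sum1_card natr_sum mulr_sumr; apply: eq_big => F.
  rewrite inE [X in _ = _ && X](_ : _ = (face_hull F == W')) // andbC.
  case: (eqVneq (face_hull F) W') => [FW'|_]; last by rewrite !andbF.
  by have := hull_leP F W rH; rewrite FW' [(W <= W')%O]WW' !andbT => <-.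
by rewrite inE => /andP[/eqP <- _]; rewrite mulr1 -(adim_hull F rH).
Qed.

Lemma sum_weight H (X : set V) (P : set V -> Prop) (p : pred (face H)) :
  (forall F, p F = `[< P (val F) >]) ->
  \sum_(F : face H | `[< val F `<=` X >] && p F) (-1) ^+ adim (val F) =
  \sum_(F : face H | `[< val F `<=` X >]) weight P (val F).
Proof. by move=> pP; rewrite big_mkcondr; apply: eq_bigr => F _; rewrite pP. Qed.

Lemma hull_nonempty H (F : face H) : val (face_hull F) !=set0.
Proof. by have [x Fx] := face_rep F; exists x; exact: sub_aff_hull. Qed.

Lemma mobius_sign (a : nat) (N S : int) : S = (-1) ^+ a * N -> N = (-1) ^+ a * S.
Proof. by move=> ->; rewrite mulrA -expr2 sqrr_sign mul1r. Qed.

(** Being above [G] is adherence to one point [p] of [G], and [p] lies in every flat of the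
    interval, so each of them contributes [(-1)^dim W]. The factor [(-1)^dim X] left by
    [mobius_count] turns this sign into that of the rank. *)
Lemma count_faces_above H fs (G : face H) (X : lattice H) : represents H fs ->
  separating fs -> (X <= face_hull G)%O ->
  (#|[pred F : face H | (face_hull F == X) && (G <= F)%O]|)%:Z =
  Z (Some X : adjoin_min (lattice H)) (Some (face_hull G)).
Proof.
move=> rH sep XG; have [p Gp] := face_rep G.
have pP F : (G <= F)%O = `[< adherent p (val F) >].
  by apply/idP/asboolP => /(face_leP F rH Gp).
pose h (z : adjoin_min (lattice H)) : int :=
  if z is Some W then (-1) ^+ adim (val W) else 0.
have GY (W : lattice H) : (W <= face_hull G)%O -> val W p.
  by move=> /lattice_leP; apply; exact: sub_aff_hull.
have := @mobius_count H fs (fun F => (G <= F)%O) X (face_hull G) h rH XG.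
move=> /(_ _ _)/mobius_sign ->.
- rewrite mulr_sumr /Z; apply: eq_bigr => -[W|//] /andP[XW WG].
  rewrite (rank_lattice rH sep XW) !height_nonempty; first last.
  + by exists p; exact: GY.
  + by exists p; exact: GY.
  rewrite subSS signr_sub; first by rewrite /h mulrCA mulrC mulrAC mulrC mulrA mulrAC.
  have [->//|/eqP ne] := eqVneq W X; rewrite -ltnS -!height_nonempty; first last.
  + by exists p; exact: GY.
  + by exists p; exact: GY.
  apply: ltnW; apply: (height_lt rH (valP X) (valP W)); first exact/lattice_leP.
  by move=> /val_inj.
(* An equation vanishing on [F] vanishes on its closure, so the hull of [F] contains [G]. *)
- move=> F GF; rewrite (hull_leP _ _ rH); apply/asboolP.
  apply: (flat_face_sub rH (valP (face_hull F)) _ Gp).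
  have [gs gfs hE] := (flats_zeros _ rH).1 (valP (face_hull F)).
  rewrite hE => f fgs; have [y Fy] := face_rep F.
  have y0 : sgn f y = 0.
    apply/sgn_eq0; have : val (face_hull F) y by exact: sub_aff_hull.
    by rewrite hE => /(_ f fgs).
  have /asboolP/(adherent_face _ rH Fy)/(_ f (gfs _ fgs)) : `[< adherent p (val F) >].
    by rewrite -pP.
  by rewrite y0 => -[] /sgn_eq0.
- move=> W XW WG; rewrite (sum_weight _ pP) (sum_adherent rH (valP W)) //; exact: GY.
Qed.

Lemma count_unbounded H fs (X : lattice H) : represents H fs -> separating fs ->
  noncentral H -> val X !=set0 ->
  (#|[pred F : face H | (face_hull F == X) && ~~ `[< bounded_set (val F) >]]|)%:Z =
  Zub (Some X : adjoin_min (lattice H)) \top%O.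
Proof.
move=> rH sep nc X0.
have pP (F : face H) : ~~ `[< bounded_set (val F) >] = `[< has_ray (val F) >].
  rewrite -asbool_neg; apply: asbool_equiv_eq; split;
    first exact: (@unbounded_ray _ _ H fs F rH).
  exact: ray_unbounded.
pose h (z : adjoin_min (lattice H)) : int :=
  if z is Some W then if `[< val W !=set0 >] then (-1) ^+ adim (val W) - 1 else 0 else 0.
have := @mobius_count H fs (fun F => ~~ `[< bounded_set (val F) >]) X \top%O h rH (lex1 _).
move=> /(_ _ _)/mobius_sign ->; first last.
- move=> W XW _; rewrite (sum_weight _ pP) /h; case: asboolP => W0.
    exact: (sum_ray rH sep (valP W)).
  rewrite big1 // => F /asboolP FW; case: W0; have [y Fy] := face_rep F.
  by exists y; exact: FW.
- by move=> F _; exact: lex1.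
have top0 : fsval (\top%O : lattice H) = set0 by exact: lattice_topE.
have ltX : ((Some X : adjoin_min (lattice H)) < \top)%O.
  rewrite lt_neqAle lex1 andbT; apply/eqP => -[e]; case: X0 => z.
  by rewrite e -[val _]/(fsval (\top%O : lattice H)) top0.
(* The empty flat is split off from three sums: the inverted one, where [h] is 0; [Z], where it
   contributes [Zb]; and the sum of all Moebius values, which is 0 and gives
   [S = - mobius X \top]. *)
rewrite /Zub /Zb /Z (bigD1 \top%O) /=; last by rewrite lex1 lexx.
rewrite [X in _ = X - _](bigD1 \top%O) /=; last by rewrite lex1 lexx.
have := sum_mobius (Some X : adjoin_min (lattice H)) \top%O.
rewrite (lt_eqF ltX) (bigD1 \top%O) /=; last by rewrite lex1 lexx.
set S := \sum_(_ | _) mobius _ _; move/eqP; rewrite addrC addr_eq0 => /eqP Sm.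
rewrite {1}/h asboolF; last first.
  by move: top0 => /= -> [].
rewrite mulr0 add0r (rank_lattice rH sep (lex1 X)).
rewrite [X in (_ - height X)%N]top0 height_set0 subn0 height_nonempty //.
transitivity (\sum_(z : adjoin_min (lattice H) | (((Some X : adjoin_min (lattice H)) <=
  z)%O && (z <= \top)%O) && (z != \top%O))
   (-1) ^+ rank (Some X : adjoin_min (lattice H)) z * mobius (Some X : adjoin_min
     (lattice H)) z
   - (-1) ^+ adim (val X) * S); last first.
  have ident (a e m : int) : a - e * - m = -1 * e * m + a - 2 * (-1 * e * m) by ring.
  by rewrite Sm exprS; exact: ident.
rewrite /S !mulr_sumr -sumrB; apply: eq_bigr => -[W|//] /andP[/andP[XW _] Wt].
have W0 : val W !=set0.
  by apply/set0P; apply: contra Wt => /eqP W0; apply/eqP; congr Some; apply/val_inj;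
    exact: etrans W0 (esym top0).
rewrite (rank_lattice rH sep XW) !height_nonempty // subSS signr_sub; last first.
  have [->//|/eqP ne] := eqVneq W X; rewrite -ltnS -!height_nonempty //.
  apply: ltnW; apply: (height_lt rH (valP X) (valP W)); first exact/lattice_leP.
  by move=> /val_inj.
have ident (a w m : int) : a * (m * (w - 1)) = a * w * m - a * m by ring.
by rewrite /h asboolT //; exact: ident.
Qed.

End FaceCount.

(** * Chains of unbounded faces *)

Lemma chain_consecutive (d : Order.disp_t) (P : finPOrderType d) m (c : 'I_m.+1 -> P) :
  chain c = [forall i : 'I_m, (c (widen_ord (leqnSn m) i) < c (lift ord0 i))%O].
Proof.
apply/forallP/forallP => [h i|h i].
  by move: (h (widen_ord (leqnSn m) i)) => /forallP/(_ (lift ord0 i))/implyP; apply.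
apply/forallP => -[j jm]; apply/implyP; rewrite [val (Ordinal _)]/=.
elim: j jm => [//|j IH] jm; rewrite [(_ < _)%N]/= ltnS leq_eqVlt.
have jm' : (j < m)%N by [].
have := h (Ordinal jm').
rewrite (_ : lift ord0 _ = Ordinal jm); last exact/val_inj.
move=> cj /orP[/eqP ij|ij].
  by rewrite (_ : i = widen_ord (leqnSn m) (Ordinal jm')) //; exact/val_inj.
apply: lt_trans cj; rewrite (_ : widen_ord _ _ = Ordinal (ltnW jm)); last exact/val_inj.
exact: IH.
Qed.

Section UnboundedFaces.
Context {R : realType} {n : nat}.
Local Notation V := 'rV[R]_n.
Implicit Types (H : {fset set V}) (fs : seq (V * R)).

(** On a bounded face [insub] returns [None], which here is the maximum of [Q]; uses are therefore
    guarded by unboundedness. *)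
Definition ub_face H (F : face H) : Q H :=
  insub (Some (Some F) : (face_lattice H)^d%type).

Lemma ub_faceE H (F : face H) : ~~ `[< bounded_set (fsval F) >] ->
  exists u : ub_ideal H, ub_face F = Some u /\ val u = Some (Some F).
Proof.
move=> ub; rewrite /ub_face; case: insubP => [u _ uE|]; first by exists u.
by rewrite /in_ub_ideal ub.
Qed.

Lemma z_ub_ub_face H (F : face H) : ~~ `[< bounded_set (fsval F) >] ->
  z_ub (ub_face F) = Some (face_hull F).
Proof. by move=> /ub_faceE[u [-> uE]]; rewrite /z_ub uE. Qed.

Lemma Q_cases H (q : Q H) :
  [\/ q = None /\ z_ub q = \top%O,
      exists u : ub_ideal H, [/\ q = Some u, val u = None & z_ub q = None] |
      exists2 F, ~~ `[< bounded_set (fsval F) >] & q = ub_face F].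
Proof.
case: q => [[[[F|]|] h]|].
- constructor 3; exists F => //; have [u [-> uE]] := ub_faceE h.
  by congr Some; apply/val_inj.
- by [].
- by constructor 2; eexists; split.
- by constructor 1.
Qed.

Lemma hull_neq_top H (F : face H) : noncentral H -> face_hull F <> \top%O.
Proof.
move=> nc e; have [x] := hull_nonempty F; rewrite e.
by have := lattice_topE nc => /= ->.
Qed.

Lemma card_ub_faces H (X : lattice H) (c : pred (Q H)) : noncentral H -> X <> \top%O ->
  #|[pred q : Q H | (z_ub q == Some X) && c q]| =
  #|[pred F : face H | (face_hull F == X) &&
      (~~ `[< bounded_set (fsval F) >] && c (ub_face F))]|.
Proof.
move=> nc Xt; rewrite -(card_in_image (f := @ub_face H)); last first.
  move=> F G /andP[_ /andP[uF _]] /andP[_ /andP[uG _]].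
  have [u [-> uE]] := ub_faceE uF; have [v [-> vE]] := ub_faceE uG.
  by move=> [uv]; move: uE; rewrite uv vE => -[].
apply: eq_card => q; rewrite [LHS]inE; apply/andP/fintype.imageP.
  case: (Q_cases q) => [[-> _]|[u [_ _ ->]]|[F uF ->]] [/eqP e cq] //.
    by case: e => e; case: Xt.
  exists F => //; move: e; rewrite z_ub_ub_face // => -[e].
  rewrite inE uF cq !andbT; apply/eqP; exact: e.
by move=> [F /andP[/eqP <- /andP[uF cF]] ->]; rewrite z_ub_ub_face.
Qed.

(** [Q] inherits its order from the dual of the face lattice, hence the reversal. *)
Lemma ub_face_lt H (F G : face H) : ~~ `[< bounded_set (fsval F) >] ->
  ~~ `[< bounded_set (fsval G) >] -> (ub_face F < ub_face G)%O = (F != G) && (G <= F)%O.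
Proof.
move=> uF uG; have [u [-> uE]] := ub_faceE uF; have [v [-> vE]] := ub_faceE uG.
rewrite lt_neqAle; congr (_ && _).
  congr (~~ _); apply/eqP/eqP => [[uv]|FG]; first by move: uE; rewrite uv vE => -[].
  by congr Some; apply/val_inj; rewrite uE vE FG.
transitivity (val u <= val v)%O; first by [].
by rewrite uE vE.
Qed.

(** A closed ball containing [F] contains its closure, hence [G]. Thus the faces above an unbounded
    one all belong to [Q], and [count_faces_above] applies without correction. *)
Lemma unbounded_above H (F G : face H) : (G <= F)%O ->
  ~~ `[< bounded_set (fsval G) >] -> ~~ `[< bounded_set (fsval F) >].
Proof.
move=> /asboolP GF; apply: contra => /asboolP [M [Mr hM]]; apply/asboolP.
exists M; split => // N MN x Gx /=.
have cl : closed [set y : V | `|y| <= N].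
  have -> : [set y : V | `|y| <= N]%classic = ((fun y : V => `|y|) @^-1` [set r | r <=
    N])%classic by [].
  by apply: preimage_closed; [move=> w _; exact: norm_continuous|exact: closed_le].
apply: cl => B Bx; have [y [Fy By]] := GF _ Gx _ Bx.
by exists y; split => //; exact: (hM N MN y Fy).
Qed.

Lemma card_below H fs (X Y : lattice H) (t : Q H) : represents H fs -> separating fs ->
  noncentral H -> (X < Y)%O -> Y <> \top%O -> z_ub t = Some Y ->
  (#|[pred q : Q H | (z_ub q == Some X) && (q < t)%O]|)%:Z =
  Z (Some X : adjoin_min (lattice H)) (Some Y).
Proof.
move=> rH sep nc XY Yt; case: (Q_cases t) => [[_ ->]|[u [_ _ ->]]|[G uG ->]] //.
  by move=> [e]; case: Yt.
rewrite z_ub_ub_face // => -[GY].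
have Xt : X <> \top%O by move=> e; move: (lt_le_trans XY (lex1 Y)); rewrite e ltxx.
rewrite card_ub_faces // -GY -(count_faces_above rH sep); last by rewrite GY ltW.
congr Posz; apply: eq_card => F; rewrite !inE; case: eqVneq => //= FX.
apply/andP/idP => [[uF]|GF]; first by rewrite ub_face_lt // => /andP[].
have uF := unbounded_above GF uG; rewrite ub_face_lt // GF andbT; split=> //.
by apply/eqP => FG; move: XY; rewrite -FX -GY FG ltxx.
Qed.

Lemma card_below_top H fs (X : lattice H) (t : Q H) : represents H fs -> separating fs ->
  noncentral H -> X <> \top%O -> z_ub t = \top%O ->
  (#|[pred q : Q H | (z_ub q == Some X) && (q < t)%O]|)%:Z =
  Zub (Some X : adjoin_min (lattice H)) \top%O.
Proof.
move=> rH sep nc Xt; case: (Q_cases t) => [[-> _]|[u [_ _ ->]]|[G uG ->]] //; last first.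
  by rewrite z_ub_ub_face // => /Some_inj e; case: (hull_neq_top nc e).
move=> _; rewrite card_ub_faces // -(count_unbounded rH sep nc); last first.
  apply/set0P; apply/eqP => X0; apply: Xt; apply/val_inj; rewrite /= X0.
  by have := lattice_topE nc => /= ->.
congr Posz; apply: eq_card => F; rewrite !inE; congr (_ && _).
case: (boolP (~~ _)) => //= uF; have [u [-> _]] := ub_faceE uF.
by rewrite lt_neqAle lex1 andbT.
Qed.

Lemma card_below_bot H (t : Q H) : z_ub t <> None ->
  #|[pred q : Q H | (z_ub q == None) && (q < t)%O]| = 1%N.
Proof.
move=> tb; have hb : in_ub_ideal (None : (face_lattice H)^d%type) by [].
pose b : Q H := Some (exist _ (None : (face_lattice H)^d%type) hb : ub_ideal H).
rewrite (eq_card (B := pred1 b)) ?card1 // => q; rewrite !inE.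
apply/andP/eqP => [[/eqP]|->].
  case: (Q_cases q) => [[_ ->]//|[u [-> uE _]] _ _|[F uF ->]].
    by congr Some; apply/val_inj; rewrite uE.
  by rewrite z_ub_ub_face.
split => //; rewrite lt_neqAle; apply/andP; split.
  by apply/eqP => e; apply: tb; rewrite -e.
case: t {tb} => [u|]; last exact: lex1.
have : (val (exist _ (None : (face_lattice H)^d%type) hb : ub_ideal H) <= val u)%O by
  exact: (lex1 (val u : face_lattice H)).
by [].
Qed.

Lemma card_top H : noncentral H ->
  #|[pred q : Q H | z_ub q == \top%O]| = 1%N.
Proof.
move=> nc; rewrite (eq_card (B := pred1 (None : Q H))) ?card1 // => q; rewrite !inE.
apply/eqP/eqP => [|->//].
case: (Q_cases q) => [[-> _]//|[u [_ _ ->]]//|[F uF ->]].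
by rewrite z_ub_ub_face // => /Some_inj e; case: (hull_neq_top nc e).
Qed.

End UnboundedFaces.

Theorem theorem1p36 (R : realType) (n : nat) (H : {fset set 'rV[R]_n})
    (H_hyp : forall h, h \in H -> is_hyperplane h)
    (H_ess : essential H) (H_nc : noncentral H)
    (k : nat) (k_ge2 : (2 <= k)%N)
    (x : 'I_k.+1 -> adjoin_min (lattice H)) (x_chain : chain x)
    (x_bot : x ord0 = \bot%O) (x_top : x ord_max = \top%O) :
  (#|[pred y : {ffun 'I_k.+1 -> Q H} |
       chain y && [forall i, z_ub (y i) == x i]]|)%:Z =
  (\prod_(2 <= i < k) Z (x (inord i.-1)) (x (inord i))) *
    Zub (x (inord k.-1)) (x (inord k)).
Proof.
case: k k_ge2 x x_chain x_bot x_top => [|[|m]] // k_ge2 x x_chain x_bot x_top.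
have [fs rH] := exists_represents H_hyp.
have sep := essential_separating rH H_ess.
have x_lt i j : (i < j)%N -> (j <= m.+2)%N -> (x (inord i) < x (inord j))%O.
  move=> ij jk; move/forallP: x_chain => /(_ (inord i))/forallP/(_ (inord j))/implyP.
  by apply; rewrite !inordK ?ltnS // (leq_trans (ltnW ij)).
have x0 : x (inord 0) = None by rewrite -[RHS]x_bot; congr x; apply/val_inj;
  rewrite /= inordK.
have xk : x (inord m.+2) = \top%O by rewrite -x_top; congr x; apply/val_inj;
  rewrite /= inordK.
have xS i : (0 < i)%N -> (i <= m.+2)%N -> exists X, x (inord i) = Some X.
  move=> i0 ik; have := x_lt 0%N i i0 ik; rewrite x0.
  by case: (x (inord i)) => [X _|]; [exists X|rewrite ltxx].
have x_ntop i X : (i < m.+2)%N -> x (inord i) = Some X -> X <> \top%O.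
  move=> ik xi Xt; have := x_lt i m.+2 ik (leqnn m.+2).
  by rewrite xk xi Xt ltxx.
pose A (i : 'I_m.+3) : pred (Q H) := [pred q | z_ub q == x i].
(* The number of choices for [y_i] below a given [y_(i+1)]: one at [i = 0], where [y_i] is the
   minimum of [Q], and [Zub] just below the top. The factor with index [j] in the statement is [c]
   at [j - 1]. *)
pose c (i : 'I_m.+2) : int :=
  if i == 0%N :> nat then 1 else
  if i == m.+1 :> nat then Zub (x (inord m.+1)) (x (inord m.+2))
  else Z (x (inord i)) (x (inord i.+1)).
have wE (i : 'I_m.+2) : widen_ord (leqnSn m.+2) i = inord i.
  by apply/val_inj; rewrite /= inordK // ltnS ltnW.
have lE (i : 'I_m.+2) : lift ord0 i = inord i.+1.
  by apply/val_inj; rewrite /= inordK // ltnS.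
have := @count_chains _ <%O m.+2 A c.
rewrite (eq_card (B := [pred y : {ffun 'I_m.+3 -> Q H} |
       chain y && [forall i, z_ub (y i) == x i]])); last first.
  by move=> y; rewrite !inE chain_consecutive andbC.
move=> ->.
  (* The top entry is forced: non-centrality keeps every face hull different from the empty flat. *)
  rewrite (_ : #|A ord_max| = 1%N) ?mulr1; last by rewrite -(card_top H_nc) -x_top.
  rewrite big_ord_recl big_ord_recr /= mul1r; congr (_ * _).
    rewrite big_add1 big_add1 big_mkord; apply: eq_bigr => i _.
    by rewrite /c /= /bump /= add1n eqSS ltn_eqF.
  by rewrite /c /= /bump /= add1n eqxx.
move=> i t; rewrite /A /= wE lE => /eqP zt; rewrite /c.
have ik := ltn_ord i.
case: eqP => [i0|/eqP i0].
  rewrite i0 x0 card_below_bot // zt i0.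
  by have [X ->] := xS 1%N isT isT.
have [X xX] : exists X, x (inord i) = Some X by apply: xS; rewrite ?lt0n // ltnW.
have Xt := x_ntop _ _ ik xX.
rewrite xX; case: eqP => [ik1|/eqP ik1].
  have xm : x (inord m.+1) = Some X by rewrite -xX; congr (x (inord _)).
  have zt' : z_ub t = \top%O by rewrite zt -xk; congr (x (inord _)); rewrite ik1.
  by rewrite xm xk (card_below_top rH sep).
have ik' : (i.+1 < m.+2)%N by lia.
have [Y xY] : exists Y, x (inord i.+1) = Some Y by apply: xS.
rewrite xY (card_below (Y := Y) rH sep) //; last by rewrite zt.
  by have := x_lt i i.+1 (ltnSn _) ik; rewrite xX xY.
exact: (x_ntop _ _ ik' xY).
Qed.
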